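(* Let $e\ge 2$ and let $\mathcal C$ be a $\mathbb C$-linear artinian abelian category equipped with an $\widehat{\mathfrak{sl}}_e$-categorification with adjoint pair of functors $(U,V)$, $V=\bigoplus_{i=0}^{e-1}V_i$. Suppose that the $\widehat{\mathfrak{sl}}_e$-module $K_0(\mathcal C)$ is in $\mathcal O_{\mathrm{int}}$, with decomposition $K_0(\mathcal C)\cong\bigoplus_j L(\lambda_j)$ into irreducible highest weight modules, $\lambda_j\in P^+$. Let $B(\mathcal C)$ be the crystal graph of the perfect basis of $K_0(\mathcal C)$ given by the classes of simple objects, and let $$\Psi: B(\mathcal C)\to \coprod_j B_e(\mathbf s_{\lambda_j})$$ be an isomorphism of crystal graphs. Let $S\in\mathcal C$ be simple, and let $r\ge 0$ and $\mathbf s\in\widetilde{\mathbb Z_{\ge 0}^r}$ be such that $\Psi([S])$ lies in a component $B_e(\mathbf s)$ (i.e. in a component $B_e(\mathbf s_{\lambda_j})$ with $\mathbf s_{\lambda_j}=\mathbf s$). Then $V(S)$ has at least $r$ constituents.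
   Context: Constituents are composition factors, counted with multiplicity. **Lie algebra.** $\widehat{\mathfrak{sl}}_e$ is the affine Kac–Moody algebra of type $A^{(1)}_{e-1}$ over $\mathbb C$, with Chevalley generators $e_i,f_i$ ($0\le i\le e-1$) and Cartan subalgebra $\mathfrak h$ with basis $h_0,\dots,h_{e-1},d$; $\Lambda_0,\dots,\Lambda_{e-1},\partial$ is the dual basis of $\mathfrak h^*$ (fundamental weights and null root; $\Lambda_z:=\Lambda_{z \bmod e}$ for $z\in\mathbb Z$), and $\alpha_i=-\Lambda_{i-1}+2\Lambda_i-\Lambda_{i+1}+\delta_{0,i}\partial$ are the simple roots. $P=\mathbb Z\partial\oplus\bigoplus_i\mathbb Z\Lambda_i$, $P^+=\mathbb Z\partial\oplus\bigoplus_i\mathbb Z_{\ge0}\Lambda_i$. $L(\lambda)$ is the irreducible highest weight module of highest weight $\lambda$. A module is integrable if all $e_i,f_i$ act locally nilpotently. A module $M$ is in $\mathcal O_{\mathrm{int}}$ if it is integrable, is the direct sum of its weight spaces, which are finite dimensional, and its weights lie in $F+\sum_i\mathbb Z_{\le0}\alpha_i$ for some finite $F\subseteq P$. **Categorification.** Put $q=\exp(2\pi\sqrt{-1}/e)$. An $\widehat{\mathfrak{sl}}_e$-categorification on $\mathcal C$ consists of an adjoint pair $(U,V)$ of exact functors $\mathcal C\to\mathcal C$, $X\in\mathrm{End}(U)$, $T\in\mathrm{End}(U^2)$, and a decomposition $\mathcal C=\bigoplus_{\lambda\in P}\mathcal C_\lambda$ such that, with $U_i$ (resp. $V_i$) the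 generalized $q^i$-eigenspace of $X$ acting on $U$ (resp. on $V$, via adjunction), $0\le i\le e-1$: (i) $U=\bigoplus_{i=0}^{e-1}U_i$; (ii) $(1_UT)\circ(T1_U)\circ(1_UT)=(T1_U)\circ(1_UT)\circ(T1_U)$, $(T+1_{U^2})\circ(T-q1_{U^2})=0$, $T\circ(1_UX)\circ T=qX1_U$; (iii) $e_i\mapsto U_i$, $f_i\mapsto V_i$ defines an integrable representation of $\widehat{\mathfrak{sl}}_e$ on $K_0(\mathcal C):=\mathbb C\otimes_{\mathbb Z}R_0(\mathcal C)$, where $R_0(\mathcal C)$ is the Grothendieck group, with $K_0(\mathcal C_\lambda)$ as weight space of weight $\lambda$; (iv) $U_i(\mathcal C_\lambda)\subseteq\mathcal C_{\lambda+\alpha_i}$ and $V_i(\mathcal C_\lambda)\subseteq\mathcal C_{\lambda-\alpha_i}$; (v) $V$ is isomorphic to a left adjoint of $U$. **The graph $B(\mathcal C)$.** Its vertices are the classes $[S]$ of simple objects up to isomorphism; there is an edge $[S]\xrightarrow{i}[S']$ if and only if $\mathrm{head}(V_i(S))\cong S'$ (for simple $S$, the head of $V_i(S)$ is known to be simple or $0$). A crystal graph isomorphism is a bijection on vertices preserving and reflecting $i$-coloured directed edges for all $i$. **The graphs $B_e(\mathbf s)$.** For $r\ge1$ let $\widetilde{\mathbb Z_{\ge0}^r}=\{(t_1,\dots,t_r)\in\mathbb Z^r\mid 0\le t_1\le\dots\le t_r<e\}$ and $\widetilde{\mathbb Z_{\ge0}^0}=\{\mathbf 0\}$, with $\mathbf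 0$ the empty sequence. For $\lambda\in P^+$, $\mathbf s_\lambda=(t_1,\dots,t_r)$ is the unique element of $\bigcup_{r\ge 0}\widetilde{\mathbb Z_{\ge0}^r}$ with $\Lambda_{t_1}+\dots+\Lambda_{t_r}\equiv\lambda \pmod{\mathbb Z\partial}$. Let $r\geq 1$, $\mathbf s=(s_1,\dots,s_r)\in\widetilde{\mathbb Z_{\ge0}^r}$. An $r$-multipartition of $n$ is an $r$-tuple $\lambda=(\lambda^{(1)},\dots,\lambda^{(r)})$ of partitions of total size $n$, with Young diagram $[\lambda]=\{(a,b,c)\mid 1\le b\le\lambda^{(c)}_a,\ 1\le c\le r\}$, whose elements are called nodes; addable and removable nodes are defined as usual. Node $(a,b,c)$ is higher than $(a',b',c')$ if $c<c'$, or $c=c'$ and $a<a'$, or $c=c'$, $a=a'$ and $b>b'$. The residue of $(a,b,c)$ is $b-a+s_c \bmod e$; an $i$-node is a node of residue $i$. For each $0\le i\le e-1$ list the addable and removable $i$-nodes of $\lambda$ from highest to lowest, writing $+$ for addable and $-$ for removable, and recursively delete adjacent pairs $-+$ until none remain. Nodes of the remaining $-$ (resp. $+$) are $i$-normal (resp. $i$-co-normal); the highest $i$-normal node is $i$-good and the lowest $i$-co-normal node is $i$-co-good. Let $\mathcal P_r$ be the set of all $r$-multipartitions (of all $n\ge0$), and draw an edge $\lambda\xrightarrow{i}\mu$ if and only if $\mu$ is obtained from $\lambda$ by adding its $i$-co-good node. $B_e(\mathbf s)$ is the connected component of the empty multipartition in this graph. $B_e(\mathbf 0)$ (case $r=0$)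 is the graph with one vertex and no edges. *)

(* Defs.v *)
From HB Require Import structures.
From Stdlib Require Import Relations.
From mathcomp Require Import all_boot all_order all_algebra.
From mathcomp Require Import generic_quotient ring_quotient.
From mathcomp Require Import boolp reals trigo.
From mathcomp Require Import complex monalg.

Set Implicit Arguments.
Unset Strict Implicit.
Unset Printing Implicit Defensive.

Import Order.TTheory GRing.Theory Num.Theory.
Local Open Scope ring_scope.
Local Open Scope quotient_scope.

Section Subspaces.
Variables (k : fieldType) (V : lmodType k).

Definition is_subspace (W : V -> Prop) : Prop :=
  W 0 /\ forall (a : k) (x y : V), W x -> W y -> W (a *: x + y).

Definition in_span (G : V -> Prop) (x : V) : Prop :=
  forall W : V -> Prop, is_subspace W -> (forall g, G g -> W g) -> W x.

Definition finite_dim (W : V -> Prop) : Prop :=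
  exists (n : nat) (b : 'I_n -> V),
    forall v, W v -> exists c : 'I_n -> k, v = \sum_(l < n) c l *: b l.

Definition is_direct_sum (J : Type) (W : J -> V -> Prop) : Prop :=
  (forall v, exists (n : nat) (t : 'I_n -> J) (w : 'I_n -> V),
      (forall l, W (t l) (w l)) /\ v = \sum_(l < n) w l) /\
  (forall (n : nat) (t : 'I_n -> J) (w : 'I_n -> V), injective t ->
      (forall l, W (t l) (w l)) -> \sum_(l < n) w l = 0 -> forall l, w l = 0).

End Subspaces.

Section QuotientSpace.
Variables (k : fieldType) (V : lmodType k) (G : V -> Prop).

Definition span_pred : {pred V} := fun x => `[< in_span G x >].

Fact span_zmod_closed : zmod_closed span_pred.
Proof.
split; first by apply/asboolP => W [W0 _] _.
move=> x y /asboolP sx /asboolP sy; apply/asboolP => W hW GW.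
rewrite addrC -scaleN1r; case: (hW) => _; apply.
  exact: sy.
exact: sx.
Qed.

HB.instance Definition _ := GRing.isZmodClosed.Build V span_pred span_zmod_closed.

Definition quotspace : Type := Quotient.quot span_pred.

HB.instance Definition _ := GRing.Zmodule.on quotspace.

Definition quot_proj (x : V) : quotspace := \pi_(Quotient.quot span_pred) x.

Definition quot_scale (a : k) (x : quotspace) : quotspace :=
  quot_proj (a *: repr x).

Fact quot_projE (x y : V) :
  in_span G (x - y) <-> quot_proj x = quot_proj y.
Proof.
split=> [sxy|/eqmodP]; last by rewrite /= Quotient.equivE => /asboolP.
by apply/eqmodP; rewrite /= Quotient.equivE; apply/asboolP.
Qed.

Fact quot_scaleE (a : k) (x : V) :
  quot_scale a (quot_proj x) = quot_proj (a *: x).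
Proof.
apply/quot_projE; rewrite -scalerBr => W hW GW.
have sx : in_span G (repr (quot_proj x) - x).
  by apply/quot_projE; rewrite /quot_proj reprK.
case: (hW) => W0 WD; rewrite -[_ *: _]addr0.
by apply: WD => //; apply: sx.
Qed.

Fact quot_projD (x y : V) : quot_proj (x + y) = quot_proj x + quot_proj y.
Proof. by rewrite /quot_proj raddfD. Qed.

Fact quot_projP (x : quotspace) : exists v, x = quot_proj v.
Proof. by exists (repr x); rewrite /quot_proj reprK. Qed.

Fact quot_scaleA (a b : k) (x : quotspace) :
  quot_scale a (quot_scale b x) = quot_scale (a * b) x.
Proof. by have [v ->] := quot_projP x; rewrite !quot_scaleE scalerA. Qed.

Fact quot_scale1 : left_id 1 quot_scale.
Proof. by move=> x; have [v ->] := quot_projP x; rewrite quot_scaleE scale1r. Qed.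

Fact quot_scaleDr : right_distributive quot_scale +%R.
Proof.
move=> a x y; have [v ->] := quot_projP x; have [w ->] := quot_projP y.
by rewrite -quot_projD !quot_scaleE scalerDr quot_projD.
Qed.

Fact quot_scaleDl (x : quotspace) : {morph quot_scale^~ x : a b / a + b}.
Proof.
move=> a b; have [v ->] := quot_projP x.
by rewrite !quot_scaleE scalerDl quot_projD.
Qed.

HB.instance Definition _ := GRing.Zmodule_isLmodule.Build k quotspace
  quot_scaleA quot_scale1 quot_scaleDr quot_scaleDl.

End QuotientSpace.

Record lincat (k : fieldType) := LinCat {
  ob :> Type;
  mor : ob -> ob -> lmodType k;
  idm : forall A, mor A A;
  mcomp : forall A B D, mor B D -> mor A B -> mor A D;
  comp_idl : forall A B (f : mor A B), mcomp (idm B) f = f;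
  comp_idr : forall A B (f : mor A B), mcomp f (idm A) = f;
  compA : forall A B D F (h : mor D F) (g : mor B D) (f : mor A B),
    mcomp h (mcomp g f) = mcomp (mcomp h g) f;
  comp_linl : forall A B D (a : k) (g g' : mor B D) (f : mor A B),
    mcomp (a *: g + g') f = a *: mcomp g f + mcomp g' f;
  comp_linr : forall A B D (a : k) (g : mor B D) (f f' : mor A B),
    mcomp g (a *: f + f') = a *: mcomp g f + mcomp g f'
}.

Arguments mor {k _} A B.
Arguments idm {k _} A.
Notation "g \oc f" := (mcomp g f) (at level 40, left associativity).

Section Categories.
Variables (k : fieldType) (C : lincat k).
Implicit Types A B M N S : C.

Definition is_mono A B (f : mor A B) : Prop :=
  forall D (g h : mor D A), f \oc g = f \oc h -> g = h.
Definition is_epi A B (f : mor A B) : Prop :=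
  forall D (g h : mor B D), g \oc f = h \oc f -> g = h.
Definition is_iso A B (f : mor A B) : Prop :=
  exists g : mor B A, g \oc f = idm A /\ f \oc g = idm B.
Definition isoc A B : Prop := exists f : mor A B, is_iso f.

Definition is_zero A : Prop :=
  forall B, (forall f : mor A B, f = 0) /\ (forall f : mor B A, f = 0).

Definition is_kernel A B K (f : mor A B) (i : mor K A) : Prop :=
  f \oc i = 0 /\
  forall D (g : mor D A), f \oc g = 0 -> exists! h : mor D K, i \oc h = g.
Definition is_cokernel A B K (f : mor A B) (p : mor B K) : Prop :=
  p \oc f = 0 /\
  forall D (g : mor B D), g \oc f = 0 -> exists! h : mor K D, h \oc p = g.

(* The morphisms inj exhibit M as the direct sum of the family N; the empty
   family gives the zero objects. *)
Definition is_sum_via (I : finType) (N : I -> C) M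
    (inj : forall i, mor (N i) M) : Prop :=
  exists prj : forall i, mor M (N i),
    [/\ forall i, prj i \oc inj i = idm (N i),
        forall i j, i != j -> prj j \oc inj i = 0
      & \sum_(i : I) inj i \oc prj i = idm M].
Definition is_sum (I : finType) (N : I -> C) M : Prop :=
  exists inj : forall i, mor (N i) M, is_sum_via inj.

Definition abelian : Prop :=
  [/\ forall n (N : 'I_n -> C), exists M, is_sum N M,
      forall A B (f : mor A B), exists K (i : mor K A), is_kernel f i,
      forall A B (f : mor A B), exists K (p : mor B K), is_cokernel f p,
      forall A B (f : mor A B), is_mono f ->
        exists D (g : mor B D), is_kernel g f
    & forall A B (f : mor A B), is_epi f ->
        exists D (g : mor D A), is_cokernel g f].

Definition short_exact A B D (f : mor A B) (g : mor B D) : Prop :=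
  is_kernel g f /\ is_cokernel f g.

Definition is_simple S : Prop :=
  ~ is_zero S /\ forall A (f : mor A S), is_mono f -> is_zero A \/ is_iso f.

(* comp_factors M l: some composition series of M has l as its list of
   factors, from the top of M down. *)
Inductive comp_factors : C -> seq C -> Prop :=
| cf_zero M : is_zero M -> comp_factors M [::]
| cf_simple_top A M S (f : mor A M) (g : mor M S) l :
    short_exact f g -> is_simple S -> comp_factors A l ->
    comp_factors M (S :: l).

Definition artinian : Prop :=
  (forall A B, finite_dim (fun _ : mor A B => True)) /\
  (forall M, exists l, comp_factors M l).

Definition at_least_constituents (r : nat) M : Prop :=
  exists l, comp_factors M l /\ (r <= size l)%N.

Definition semisimple M : Prop :=
  exists (n : nat) (N : 'I_n -> C), (forall l, is_simple (N l)) /\ is_sum N M.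

(* H is the largest semisimple quotient of M. *)
Definition is_head M H : Prop :=
  exists p : mor M H, [/\ is_epi p, semisimple H
    & forall N (g : mor M N), semisimple N -> exists h, h \oc p = g].

Definition endo_pow M (x : mor M M) (n : nat) : mor M M :=
  iter n (fun y => x \oc y) (idm M).

(* i is the inclusion in M of the generalized a-eigenspace of x, that is, of
   the stable value of Ker (x - a)^m for m large. *)
Definition is_gen_eigenspace M (x : mor M M) (a : k) K (i : mor K M) : Prop :=
  exists n, forall m, (n <= m)%N ->
    is_kernel (endo_pow (x - a *: idm M) m) i.

(* K_0(C) = C (x)_Z R_0(C), presented over the ground field: the free vector
   space on the objects modulo [B] - [A] - [D] for 0 -> A -> B -> D -> 0. *)
Definition freespace : lmodType k := {malg k[{classic C}]}.
Definition obgen M : freespace := mkmalgU (M : {classic C}) 1.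
Definition exact_relator (x : freespace) : Prop :=
  exists A B D (f : mor A B) (g : mor B D),
    short_exact f g /\ x = obgen B - obgen A - obgen D.
Definition K0 : lmodType k := quotspace exact_relator.
Definition cl M : K0 := quot_proj exact_relator (obgen M).

End Categories.

Record linfunctor (k : fieldType) (C : lincat k) := LinFunctor {
  fob :> C -> C;
  fmap : forall A B, mor A B -> mor (fob A) (fob B);
  fmap_id : forall A, fmap (idm A) = idm (fob A);
  fmap_comp : forall A B D (g : mor B D) (f : mor A B),
    fmap (g \oc f) = fmap g \oc fmap f;
  fmap_lin : forall A B (a : k) (f g : mor A B),
    fmap (a *: f + g) = a *: fmap f + fmap g
}.

Arguments fmap {k C} F {A B} f : rename.

Section Functors.
Variables (k : fieldType) (C : lincat k).
Implicit Types F G U V : linfunctor C.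

Definition exact_functor F : Prop :=
  forall A B D (f : mor A B) (g : mor B D),
    short_exact f g -> short_exact (fmap F f) (fmap F g).

Definition natural F G (t : forall A, mor (F A) (G A)) : Prop :=
  forall A B (f : mor A B), fmap G f \oc t A = t B \oc fmap F f.

Definition natural_iso F G : Prop :=
  exists t : forall A, mor (F A) (G A), natural t /\ forall A, is_iso (t A).

(* Unit and counit making F left adjoint to G. *)
Record adjunction F G := Adjunction {
  unit_ : forall A, mor A (G (F A));
  counit : forall A, mor (F (G A)) A;
  unit_nat : forall A B (f : mor A B),
    fmap G (fmap F f) \oc unit_ A = unit_ B \oc f;
  counit_nat : forall A B (f : mor A B),
    f \oc counit A = counit B \oc fmap F (fmap G f);
  triangleF : forall A, counit (F A) \oc fmap F (unit_ A) = idm (F A);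
  triangleG : forall A, fmap G (counit A) \oc unit_ (G A) = idm (G A)
}.

(* The endomorphism of G corresponding by adjunction to an endomorphism of F. *)
Definition mate F G (adj : adjunction F G) (X : forall A, mor (F A) (F A))
    (A : C) : mor (G A) (G A) :=
  fmap G (counit adj A) \oc fmap G (X (G A)) \oc unit_ adj (G A).

End Functors.

Section Weights.
Variable e : nat.

(* Coordinates on Lambda_0, ..., Lambda_(e-1) and on the null root. *)
Definition wtlattice : zmodType := ({ffun 'I_e -> int} * int)%type.

Definition Lam (i : 'I_e) : wtlattice := ([ffun j => (j == i)%:R], 0).
Definition nullroot : wtlattice := (0, 1).
Definition alpha (i : 'I_e) : wtlattice :=
  - Lam (ord_pred i) + Lam i *+ 2 - Lam (ordS i) + nullroot *+ (i == 0 :> nat).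

Definition dominant (l : wtlattice) : Prop := forall i, 0 <= l.1 i.

End Weights.

Section Modules.
Variables (e : nat) (k : fieldType).

(* The Cartan matrix entry alpha_j(h_i). *)
Definition cartan (i j : 'I_e) : int := (alpha j).1 i.

Definition ad (K : lmodType k) (f g : K -> K) : K -> K :=
  fun v => f (g v) - g (f v).

(* Representations of the Kac-Moody algebra of type A^(1)_(e-1), given by the
   Chevalley generators, the coroots h_i and d, subject to the defining
   relations. *)
Record slhat_rep (K : lmodType k) := SlhatRep {
  rE : 'I_e -> {linear K -> K};
  rF : 'I_e -> {linear K -> K};
  rH : 'I_e -> {linear K -> K};
  rD : {linear K -> K};
  rel_HH : forall i j v, ad (rH i) (rH j) v = 0;
  rel_HD : forall i v, ad (rH i) rD v = 0;
  rel_EF : forall i j v, ad (rE i) (rF j) v = if i == j then rH i v else 0;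
  rel_HE : forall i j v, ad (rH i) (rE j) v = (cartan i j)%:~R *: rE j v;
  rel_DE : forall j v, ad rD (rE j) v = ((alpha j).2)%:~R *: rE j v;
  rel_HF : forall i j v, ad (rH i) (rF j) v = - ((cartan i j)%:~R *: rF j v);
  rel_DF : forall j v, ad rD (rF j) v = - (((alpha j).2)%:~R *: rF j v);
  rel_serreE : forall i j v, i != j ->
    iter `|(1 - cartan i j)%R|%N (ad (rE i)) (rE j) v = 0;
  rel_serreF : forall i j v, i != j ->
    iter `|(1 - cartan i j)%R|%N (ad (rF i)) (rF j) v = 0
}.

(* The dual of the Cartan subalgebra, in the same coordinates as wtlattice. *)
Definition hdual : zmodType := ({ffun 'I_e -> k} * k)%type.
Definition wt_incl (l : wtlattice e) : hdual :=
  ([ffun i => (l.1 i)%:~R], (l.2)%:~R).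

Variables (K : lmodType k) (rho : slhat_rep K).

Definition weight_space (m : hdual) (v : K) : Prop :=
  (forall i, rH rho i v = m.1 i *: v) /\ rD rho v = m.2 *: v.

Definition integrable : Prop :=
  forall i v, (exists n, iter n (rE rho i) v = 0) /\
              (exists n, iter n (rF rho i) v = 0).

Definition in_Oint : Prop :=
  [/\ integrable,
      is_direct_sum weight_space,
      forall m, finite_dim (weight_space m)
    & exists Fin : seq (wtlattice e), forall m,
        (exists v, v <> 0 /\ weight_space m v) ->
        exists2 l, l \in Fin & exists c : 'I_e -> nat,
          m = wt_incl (l - \sum_(i < e) alpha i *+ c i)].

Definition is_submodule (W : K -> Prop) : Prop :=
  [/\ is_subspace W, forall i v, W v -> W (rE rho i v),
      forall i v, W v -> W (rF rho i v), forall i v, W v -> W (rH rho i v)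
    & forall v, W v -> W (rD rho v)].

(* The submodule W is isomorphic to L(l): it is irreducible and contains a
   highest weight vector of weight l (which then generates it). *)
Definition is_irr_hw (l : wtlattice e) (W : K -> Prop) : Prop :=
  [/\ is_submodule W,
      exists v, [/\ W v, v <> 0, weight_space (wt_incl l) v
                  & forall i, rE rho i v = 0]
    & forall W' : K -> Prop, is_submodule W' -> (forall v, W' v -> W v) ->
        (exists v, W' v /\ v <> 0) -> forall v, W v -> W' v].

Definition decomposes_as (J : Type) (lam : J -> wtlattice e) : Prop :=
  exists W : J -> K -> Prop,
    (forall j, is_irr_hw (lam j) (W j)) /\ is_direct_sum W.

End Modules.

Definition qroot (R : realType) (e : nat) : R[i] :=
  (cos (2 * pi / e%:R) +i* sin (2 * pi / e%:R))%C.

Record slhat_categorification (R : realType) (e : nat) (C : lincat R[i]) :=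
    SlhatCategorification {
  cU : linfunctor C;
  cV : linfunctor C;
  cU_exact : exact_functor cU;
  cV_exact : exact_functor cV;
  cadj : adjunction cU cV;
  cX : forall A, mor (cU A) (cU A);
  cX_nat : natural cX;
  cT : forall A, mor (cU (cU A)) (cU (cU A));
  cT_nat : forall A B (f : mor A B),
    fmap cU (fmap cU f) \oc cT A = cT B \oc fmap cU (fmap cU f);
  (* blk l is the class of objects of the summand C_l *)
  blk : wtlattice e -> C -> Prop;
  blk_sum : forall l n (N : 'I_n -> C) M,
    (forall t, blk l (N t)) -> is_sum N M -> blk l M;
  blk_hom : forall l m A B, l != m -> blk l A -> blk m B ->
    forall f : mor A B, f = 0;
  blk_dec : forall M, exists (n : nat) (w : 'I_n -> wtlattice e)
    (N : 'I_n -> C), (forall t, blk (w t) (N t)) /\ is_sum N M;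
  cUi : 'I_e -> linfunctor C;
  cUi_incl : forall i A, mor (cUi i A) (cU A);
  cUi_nat : forall i, natural (cUi_incl i);
  cUi_eigen : forall (i : 'I_e) A,
    is_gen_eigenspace (cX A) (qroot R e ^+ i) (cUi_incl i A);
  cVi : 'I_e -> linfunctor C;
  cVi_incl : forall i A, mor (cVi i A) (cV A);
  cVi_nat : forall i, natural (cVi_incl i);
  cVi_eigen : forall (i : 'I_e) A,
    is_gen_eigenspace (mate cadj cX A) (qroot R e ^+ i) (cVi_incl i A);
  cU_sum : forall A, is_sum_via (fun i => cUi_incl i A);
  (* At A, 1_U T is U(T_A) and T 1_U is T_(U A); likewise for X. *)
  cT_braid : forall A,
    fmap cU (cT A) \oc cT (cU A) \oc fmap cU (cT A) =
    cT (cU A) \oc fmap cU (cT A) \oc cT (cU A);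
  cT_quad : forall A,
    (cT A + idm _) \oc (cT A - qroot R e *: idm _) = 0;
  cTX : forall A,
    cT A \oc fmap cU (cX A) \oc cT A = qroot R e *: cX (cU A);
  crep : slhat_rep e (K0 C);
  crepE : forall i M, rE crep i (cl M) = cl (cUi i M);
  crepF : forall i M, rF crep i (cl M) = cl (cVi i M);
  crep_integrable : integrable crep;
  crep_weight : forall l v, weight_space crep (wt_incl R[i] l) v <->
    in_span (fun x => exists M, blk l M /\ x = cl M) v;
  cUi_blk : forall i l M, blk l M -> blk (l + alpha i) (cUi i M);
  cVi_blk : forall i l M, blk l M -> blk (l - alpha i) (cVi i M);
  cV_left_adj : exists (L : linfunctor C) (_ : adjunction L cU),
    natural_iso cV L
}.

Section CategoryCrystal.
Variables (R : realType) (e : nat) (C : lincat R[i]).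
Variable cat : slhat_categorification e C.

Definition cat_vertex : Type :=
  {P : C -> Prop | exists2 S : C, is_simple S & P = isoc S}.

Definition simple_class (S : C) (hS : is_simple S) : cat_vertex :=
  exist _ (isoc S) (ex_intro2 _ (fun S' => isoc S = isoc S') S hS erefl).

Definition cat_edge (i : 'I_e) (x y : cat_vertex) : Prop :=
  exists S S' H : C, [/\ sval x S, sval y S', is_head (cVi cat i S) H
                       & isoc H S'].

End CategoryCrystal.

Section MultipartitionCrystal.
Local Open Scope nat_scope.
Variable e : nat.

Definition is_partition (p : seq nat) : bool :=
  sorted geq p && (0 \notin p).

Definition is_multipartition (r : nat) (lam : seq (seq nat)) : bool :=
  (size lam == r) && all is_partition lam.

(* A node (a, b, c) is in row a and column b of component c; unlike in the
   usual convention all three coordinates start from 0. *)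
Definition node : Type := (nat * nat * nat)%type.

Definition row_len (lam : seq (seq nat)) (c a : nat) : nat :=
  nth 0 (nth [::] lam c) a.

Definition addable (lam : seq (seq nat)) (x : node) : bool :=
  let: (a, b, c) := x in
  [&& c < size lam, b == row_len lam c a
    & (a == 0) || (row_len lam c a < row_len lam c a.-1)].

Definition removable (lam : seq (seq nat)) (x : node) : bool :=
  let: (a, b, c) := x in
  (b.+1 == row_len lam c a) && (row_len lam c a.+1 < row_len lam c a).

Definition add_node (lam : seq (seq nat)) (x : node) : seq (seq nat) :=
  let: (a, b, c) := x in
  set_nth [::] lam c (incr_nth (nth [::] lam c) a).

Variable s : seq 'I_e.

Definition residue_is (i : 'I_e) (x : node) : bool :=
  let: (a, b, c) := x in
  (b%:Z - a%:Z + (nth 0%N [seq val t | t <- s] c)%:Z == i%:Z %[mod e])%Z.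

(* From highest to lowest, the nodes of the diagram of lam and those lying
   immediately to the right of a row, the empty row below each component
   included. All addable and removable nodes are among them. *)
Definition candidate_nodes (lam : seq (seq nat)) : seq node :=
  [seq (acb.1.2, acb.2, acb.1.1) |
    acb <- [seq (ca, b) |
      ca <- [seq (c, a) | c <- iota 0 (size lam),
                          a <- iota 0 (size (nth [::] lam c)).+1],
      b <- rev (iota 0 (row_len lam ca.1 ca.2).+1)]].

(* The sign is true for addable (+) and false for removable (-) nodes. *)
Definition signature (i : 'I_e) (lam : seq (seq nat)) : seq (node * bool) :=
  [seq (x, addable lam x) | x <- candidate_nodes lam &
     (addable lam x || removable lam x) && residue_is i x].

Fixpoint delete_pair (w : seq (node * bool)) : seq (node * bool) :=
  match w with
  | x :: (y :: w'') as w' =>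
      if ~~ x.2 && y.2 then w'' else x :: delete_pair w'
  | _ => w
  end.

Definition reduced_signature (i : 'I_e) (lam : seq (seq nat)) :
    seq (node * bool) :=
  let w := signature i lam in iter (size w) delete_pair w.

Definition co_good (i : 'I_e) (lam : seq (seq nat)) : option node :=
  ohead (rev [seq x.1 | x <- reduced_signature i lam & x.2]).

Definition mp_edge (i : 'I_e) (lam mu : seq (seq nat)) : Prop :=
  [/\ is_multipartition (size s) lam, is_multipartition (size s) mu
    & exists2 x, co_good i lam = Some x & mu = add_node lam x].

Definition empty_multipartition : seq (seq nat) := nseq (size s) [::].

(* The connected component of the empty multipartition. When s is empty it has
   the single vertex [::] and no edge. *)
Definition Be_vertex : Type :=
  {lam : seq (seq nat) |
    clos_refl_sym_trans _ (fun x y => exists i, mp_edge i x y)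
      empty_multipartition lam}.

End MultipartitionCrystal.

Definition is_charge (e : nat) (s : seq 'I_e) : bool :=
  sorted (fun t t' : 'I_e => (t <= t')%N) s.

(* s is the sequence s_l attached to the dominant weight l; it is unique. *)
Definition charge_of (e : nat) (l : wtlattice e) (s : seq 'I_e) : Prop :=
  is_charge s /\ exists n : int, \sum_(t <- s) Lam t = l + nullroot e *~ n.

Section Coproduct.
Variables (e : nat) (J : Type) (s : J -> seq 'I_e).

Definition coprod_vertex : Type := {j : J & Be_vertex (s j)}.

Definition coprod_edge (i : 'I_e) (x y : coprod_vertex) : Prop :=
  tag x = tag y /\
  mp_edge (s (tag x)) i (sval (tagged x)) (sval (tagged y)).

End Coproduct.

Definition crystal_iso (I X Y : Type) (edgeX : I -> X -> X -> Prop)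
    (edgeY : I -> Y -> Y -> Prop) (f : X -> Y) : Prop :=
  bijective f /\ forall i x y, edgeX i x y <-> edgeY i (f x) (f y).

(* Main.v *)
From HB Require Import structures.
From Stdlib Require Import Relations.
From mathcomp Require Import all_boot all_order all_algebra.
From mathcomp Require Import boolp reals trigo complex.
From mathcomp Require Import zify.
Require Import Defs.

(* Let [n_i] be the length of the outgoing i-string of [S] in the crystal graph.
   In a multipartition with r components, addable nodes outnumber removable ones
   by r, and an i-string is at least as long as the number of uncancelled [+],
   hence than the excess of addable over removable i-nodes; so the [n_i] add up
   to at least r. It remains to see that [V_i(S)] has at least [n_i]
   constituents. Exactness gives [V_i^n(S) <> 0] for [n = n_i]. If the nilpotent
   endomorphism [X - q^i] of [V_i(S)] had vanishing m-th power with [m < n], the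
   affine Hecke algebra would act on a nonzero space with all [X_j - q^i]
   nilpotent and [(X_1 - q^i)^m = 0], which is impossible. So its (n-1)-st power
   is nonzero, and its successive images are n strictly decreasing subobjects. *)

Set Implicit Arguments.
Unset Strict Implicit.
Unset Printing Implicit Defensive.

Import Order.TTheory GRing.Theory Num.Theory.
Local Open Scope ring_scope.

(** * Abelian categories and composition series *)

(** Since [X] and [T] are endomorphisms of [U] and [U^2], the Hecke algebra is made to act by
    precomposition on the spaces [mor (U^n A) S]. For [A = V_i^n S], adjunction turns the inclusion
    of [A] in [V^n S] into a nonzero vector of the joint generalized eigenspace, and turns [X] at
    the outermost position into the mate of [X] on [V(S)]; this is how nilpotency on [V_i(S)]
    becomes [(X_1 - q^i)^m = 0]. The impossibility is obtained by elementary algebra, with no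
    dimension count. With [x_j = X_j - q^i], if [x_1^m = 0] then the divided difference of [x_1^m]
    in [x_1, x_2] also vanishes, so [x_2^(m-1)] vanishes on the kernel of [x_1]. Each position costs
    one unit of the exponent, so [m < n] runs the exponent down to 0 before the positions are
    exhausted. The argument divides by [q] and by [(q - 1) q^i], hence needs [q] different from 1,
    that is [e >= 2]. *)

Section LinearCategories.
Variables (k : fieldType) (C : lincat k).
Implicit Types A B D E M N S : C.

Lemma comp0m A B D (f : mor A B) : (0 : mor B D) \oc f = 0.
Proof.
have := comp_linl (-1) (0 : mor B D) 0 f.
by rewrite scaler0 addr0 scaleN1r addNr.
Qed.

Lemma compm0 A B D (g : mor B D) : g \oc (0 : mor A B) = 0.
Proof.
have := comp_linr (-1) g (0 : mor A B) 0.
by rewrite scaler0 addr0 scaleN1r addNr.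
Qed.

Lemma compDl A B D (g h : mor B D) (f : mor A B) :
  (g + h) \oc f = g \oc f + h \oc f.
Proof. by have := comp_linl 1 g h f; rewrite !scale1r. Qed.

Lemma compDr A B D (g : mor B D) (f h : mor A B) :
  g \oc (f + h) = g \oc f + g \oc h.
Proof. by have := comp_linr 1 g f h; rewrite !scale1r. Qed.

Lemma compZl A B D (a : k) (g : mor B D) (f : mor A B) :
  (a *: g) \oc f = a *: (g \oc f).
Proof. by have := comp_linl a g 0 f; rewrite comp0m !addr0. Qed.

Lemma compZr A B D (a : k) (g : mor B D) (f : mor A B) :
  g \oc (a *: f) = a *: (g \oc f).
Proof. by have := comp_linr a g f 0; rewrite compm0 !addr0. Qed.

Lemma compNl A B D (g : mor B D) (f : mor A B) : (- g) \oc f = - (g \oc f).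
Proof. by rewrite -!scaleN1r compZl. Qed.

Lemma compNr A B D (g : mor B D) (f : mor A B) : g \oc (- f) = - (g \oc f).
Proof. by rewrite -!scaleN1r compZr. Qed.

Lemma comp_sumr (I : finType) A B D (g : mor B D) (f : I -> mor A B) :
  g \oc (\sum_i f i) = \sum_i g \oc f i.
Proof.
by elim/big_rec2: _ => [|i y z _ <-]; rewrite ?compm0 ?compDr.
Qed.

Lemma is_zero_idm A : is_zero A <-> idm A = 0.
Proof.
split=> [zA|A0 B]; first exact: (proj1 (zA A)).
split=> f; first by have := comp_idr f; rewrite A0 compm0.
by have := comp_idl f; rewrite A0 comp0m.
Qed.

Lemma mono_of_ker0 A B (f : mor A B) :
  (forall D (g : mor D A), f \oc g = 0 -> g = 0) -> is_mono f.
Proof.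
move=> f0 D g h fgh; apply/eqP; rewrite -subr_eq0; apply/eqP/f0.
by rewrite compDr compNr fgh subrr.
Qed.

Lemma epi_of_coker0 A B (f : mor A B) :
  (forall D (g : mor B D), g \oc f = 0 -> g = 0) -> is_epi f.
Proof.
move=> f0 D g h fgh; apply/eqP; rewrite -subr_eq0; apply/eqP/f0.
by rewrite compDl compNl fgh subrr.
Qed.

Lemma mono_eq0 A B D (f : mor A B) (g : mor D A) :
  is_mono f -> f \oc g = 0 -> g = 0.
Proof. by move=> mf fg0; apply: mf; rewrite fg0 compm0. Qed.

Lemma epi_eq0 A B D (f : mor A B) (g : mor B D) :
  is_epi f -> g \oc f = 0 -> g = 0.
Proof. by move=> ef gf0; apply: ef; rewrite gf0 comp0m. Qed.

Lemma kernel_mono A B K (f : mor A B) (i : mor K A) : is_kernel f i -> is_mono i.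
Proof.
move=> [fi0 univ] D g h igh.
have [|u [_ uq]] := univ D (i \oc g); first by rewrite compA fi0 comp0m.
by rewrite -(uq g) // -(uq h).
Qed.

Lemma cokernel_epi A B K (f : mor A B) (p : mor B K) : is_cokernel f p -> is_epi p.
Proof.
move=> [pf0 univ] D g h gph.
have [|u [_ uq]] := univ D (g \oc p); first by rewrite -compA pf0 compm0.
by rewrite -(uq g) // -(uq h).
Qed.

Lemma kernel_lift A B K D (f : mor A B) (i : mor K A) (g : mor D A) :
  is_kernel f i -> f \oc g = 0 -> exists h, i \oc h = g.
Proof. by move=> [_ univ] /univ[h [hE _]]; exists h. Qed.

Lemma cokernel_desc A B K D (f : mor A B) (p : mor B K) (g : mor B D) :
  is_cokernel f p -> g \oc f = 0 -> exists h, h \oc p = g.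
Proof. by move=> [_ univ] /univ[h [hE _]]; exists h. Qed.

Lemma is_kernelI A B K (f : mor A B) (i : mor K A) :
  f \oc i = 0 -> is_mono i ->
  (forall D (g : mor D A), f \oc g = 0 -> exists h, i \oc h = g) -> is_kernel f i.
Proof.
move=> fi0 mi lft; split=> // D g /lft[h hE]; exists h; split=> // h' h'E.
by apply: mi; rewrite hE.
Qed.

Lemma is_cokernelI A B K (f : mor A B) (p : mor B K) :
  p \oc f = 0 -> is_epi p ->
  (forall D (g : mor B D), g \oc f = 0 -> exists h, h \oc p = g) ->
  is_cokernel f p.
Proof.
move=> pf0 ep dsc; split=> // D g /dsc[h hE]; exists h; split=> // h' h'E.
by apply: ep; rewrite hE.
Qed.

Lemma epi_comp A B D (g : mor B D) (f : mor A B) :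
  is_epi g -> is_epi f -> is_epi (g \oc f).
Proof. by move=> eg ef E u v; rewrite !compA => /ef/eg. Qed.

Lemma mono_comp A B D (g : mor B D) (f : mor A B) :
  is_mono g -> is_mono f -> is_mono (g \oc f).
Proof. by move=> mg mf E u v; rewrite -!compA => /mg/mf. Qed.

Lemma iso_mono A B (f : mor A B) : is_iso f -> is_mono f.
Proof.
by move=> [g [gf _]] D u v /(congr1 (fun x => g \oc x)); rewrite !compA gf !comp_idl.
Qed.

Lemma iso_epi A B (f : mor A B) : is_iso f -> is_epi f.
Proof.
by move=> [g [_ fg]] D u v /(congr1 (fun x => x \oc g)); rewrite -!compA fg !comp_idr.
Qed.

Lemma split_epi A B (f : mor A B) (g : mor B A) : f \oc g = idm B -> is_epi f.
Proof.
by move=> fg D u v /(congr1 (fun x => x \oc g)); rewrite -!compA fg !comp_idr.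
Qed.

Lemma mono_split_epi_iso A B (f : mor A B) (g : mor B A) :
  is_mono f -> f \oc g = idm B -> is_iso f.
Proof.
move=> mf fg; exists g; split=> //; apply: mf.
by rewrite compA fg comp_idl comp_idr.
Qed.

Lemma epi_is_zero A B (f : mor A B) : is_epi f -> is_zero A -> is_zero B.
Proof.
move=> ef /(_ B)[f0 _]; apply/is_zero_idm/(epi_eq0 ef).
by rewrite comp_idl (f0 f).
Qed.

Lemma mono_is_zero A B (f : mor A B) : is_mono f -> is_zero B -> is_zero A.
Proof.
move=> mf /(_ A)[_ f0]; apply/is_zero_idm/(mono_eq0 mf).
by rewrite comp_idr (f0 f).
Qed.

Lemma isoc_sym A B : isoc A B -> isoc B A.
Proof. by move=> [f [g [gf fg]]]; exists g, f. Qed.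

Lemma isoc_trans B A D : isoc A B -> isoc B D -> isoc A D.
Proof.
move=> [f [g [gf fg]]] [f' [g' [gf' fg']]]; exists (f' \oc f), (g \oc g').
split; rewrite compA; first by rewrite -(compA g) gf' comp_idr.
by rewrite -(compA f') fg comp_idr.
Qed.

Lemma endo_powD M (y : mor M M) m n :
  endo_pow y (m + n) = endo_pow y m \oc endo_pow y n.
Proof.
elim: m => [|m IH]; first by rewrite add0n comp_idl.
by rewrite addSn /endo_pow /= -/(endo_pow y _) IH compA.
Qed.

Lemma endo_powSr M (y : mor M M) n : endo_pow y n.+1 = endo_pow y n \oc y.
Proof. by rewrite -addn1 endo_powD /endo_pow /= comp_idr. Qed.

Lemma endo_powS M (y : mor M M) n : endo_pow y n.+1 = y \oc endo_pow y n.
Proof. by []. Qed.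

Section Abelian.
Hypothesis abC : abelian C.

Lemma exists_kernel A B (f : mor A B) : exists K (i : mor K A), is_kernel f i.
Proof. by case: abC => _ ? *. Qed.

Lemma exists_cokernel A B (f : mor A B) : exists K (p : mor B K), is_cokernel f p.
Proof. by case: abC => _ _ ? *. Qed.

Lemma mono_is_kernel A B (f : mor A B) :
  is_mono f -> exists D (g : mor B D), is_kernel g f.
Proof. by case: abC => _ _ _ h _; apply: h. Qed.

Lemma epi_is_cokernel A B (f : mor A B) :
  is_epi f -> exists D (g : mor D A), is_cokernel g f.
Proof. by case: abC => _ _ _ _; apply. Qed.

Lemma mono_kernel_of_cokernel A B D (f : mor A B) (p : mor B D) :
  is_mono f -> is_cokernel f p -> is_kernel p f.
Proof.
move=> mf cp; have [E [g kg]] := mono_is_kernel mf.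
apply: is_kernelI => // [|X u pu0]; first by case: cp.
have [t tE] := cokernel_desc cp (proj1 kg).
by apply: (kernel_lift kg); rewrite -tE -compA pu0 compm0.
Qed.

Lemma epi_cokernel_of_kernel A B D (f : mor A B) (i : mor D A) :
  is_epi f -> is_kernel f i -> is_cokernel i f.
Proof.
move=> ef ki; have [E [g cg]] := epi_is_cokernel ef.
apply: is_cokernelI => // [|X u ui0]; first by case: ki.
have [t tE] := kernel_lift ki (proj1 cg).
by apply: (cokernel_desc cg); rewrite -tE compA ui0 comp0m.
Qed.

Lemma epi_short_exact A B D (f : mor A B) (i : mor D A) :
  is_epi f -> is_kernel f i -> short_exact i f.
Proof. by move=> ef ki; split=> //; apply: epi_cokernel_of_kernel. Qed.

(** [I] is the coimage, the cokernel of the kernel of [f]. If [m \oc g = 0], then [m] factors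
    through the cokernel [c] of [g]. The epimorphism [c \oc p] is the cokernel of some [h], which
    [f] and hence [p] kills, so [p] factors through [c \oc p]. Thus [c] has a left inverse and
    [g = 0]. *)
Lemma epi_mono_factor A B (f : mor A B) :
  exists I (p : mor A I) (m : mor I B), [/\ is_epi p, is_mono m & m \oc p = f].
Proof.
have [K [i ki]] := exists_kernel f; have [I [p cp]] := exists_cokernel i.
have [m mE] := cokernel_desc cp (proj1 ki).
have ep := cokernel_epi cp; exists I, p, m; split=> //.
apply: mono_of_ker0 => D g mg0.
have [J [c cc]] := exists_cokernel g; have ec := cokernel_epi cc.
have [t tE] := cokernel_desc cc mg0.
have [E [h ch]] := epi_is_cokernel (epi_comp ec ep).
have fh0 : f \oc h = 0.
  by rewrite -mE -tE -!compA [c \oc _]compA (proj1 ch) compm0.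
have [h' h'E] := kernel_lift ki fh0.
have ph0 : p \oc h = 0 by rewrite -h'E compA (proj1 cp) comp0m.
have [u uE] := cokernel_desc ch ph0.
have uc : u \oc c = idm I by apply: ep; rewrite -compA uE comp_idl.
by rewrite -(comp_idl g) -uc -compA (proj1 cc) compm0.
Qed.

Lemma comp_factors_isoc A M l : isoc A M -> comp_factors A l -> comp_factors M l.
Proof.
move=> [u iu]; have [v [vu uv]] := iu => cA.
case: cA u v iu vu uv => {A l} [A zA|A' A S f g l [kf cg] sS cA] u v iu vu uv.
  by apply: cf_zero; apply: epi_is_zero zA; apply: iso_epi iu.
have iv : is_iso v by exists u.
apply: (@cf_simple_top _ _ _ _ _ (u \oc f) (g \oc v)) cA => //.
have egv := epi_comp (cokernel_epi cg) (iso_epi iv).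
apply: epi_short_exact => //; apply: is_kernelI.
- by rewrite -compA [v \oc _]compA vu comp_idl; case: kf.
- exact: mono_comp (iso_mono iu) (kernel_mono kf).
- move=> D h; rewrite -compA => gvh0; have [w wE] := kernel_lift kf gvh0.
  by exists w; rewrite -compA wE compA uv comp_idl.
Qed.

(** Induction on the series of [B]: the kernel [M'] of [M -> B -> S] is again an extension, of the
    next term [B'] by [A]. *)
Lemma comp_factors_ext A M B (a : mor A M) (p : mor M B) lA lB :
  short_exact a p -> comp_factors A lA -> comp_factors B lB ->
  comp_factors M (lB ++ lA).
Proof.
move=> exM cA cB; elim: cB M a p exM => {B lB} [B zB|B' B S f g l exB sS _ IH] M a p [ka cp].
  apply: comp_factors_isoc cA; exists a.
  have [|h hE] := @kernel_lift _ _ _ _ _ _ (idm M) ka.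
    exact: (proj2 (zB M)).
  exact: mono_split_epi_iso (kernel_mono ka) hE.
have [kf cg] := exB; have ep := cokernel_epi cp; have eg := cokernel_epi cg.
have egp := epi_comp eg ep.
have [M' [i ki]] := exists_kernel (g \oc p).
have [|v vE] := @kernel_lift _ _ _ _ _ _ (p \oc i) kf.
  by rewrite compA; case: ki.
have [|a' a'E] := @kernel_lift _ _ _ _ _ _ a ki.
  by rewrite -compA (proj1 ka) compm0.
have mf := kernel_mono kf; have mi := kernel_mono ki.
rewrite cat_cons; apply: (cf_simple_top (epi_short_exact egp ki) sS).
apply: (IH _ a' v); apply: epi_short_exact.
  (* [v] is an epimorphism: if [m] is its image, the cokernel [c] of [f \oc m] satisfies
     [c \oc p \oc i = 0], so it factors through [g] and kills [f]. Hence [f] factors through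
     [f \oc m], and [m] splits. *)
  have [I [w [m [ew mm mE]]]] := epi_mono_factor v.
  have mj := mono_comp mf mm.
  have [Q [c cc]] := exists_cokernel (f \oc m).
  have cpi0 : (c \oc p) \oc i = 0.
    by rewrite -compA -vE -mE !compA -[c \oc f \oc m]compA (proj1 cc) comp0m.
  have [t tE] := cokernel_desc (epi_cokernel_of_kernel egp ki) cpi0.
  have cE : c = t \oc g by apply: ep; rewrite -compA tE.
  have cf0 : c \oc f = 0 by rewrite cE -compA (proj1 kf) compm0.
  have [u uE] := kernel_lift (mono_kernel_of_cokernel mj cc) cf0.
  rewrite -mE; apply: epi_comp ew; apply: (@split_epi _ _ _ u).
  by apply: mf; rewrite compA uE comp_idr.
apply: is_kernelI.
- by apply: (mono_eq0 mf); rewrite compA vE -compA a'E; case: ka.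
- by move=> D x y xy; apply: (kernel_mono ka); rewrite -a'E -!compA xy.
- move=> D x vx0; have [|h hE] := @kernel_lift _ _ _ _ _ _ (i \oc x) ka.
    by rewrite compA -vE -compA vx0 compm0.
  by exists h; apply: mi; rewrite compA a'E.
Qed.

Lemma at_least_ext m n A M B (a : mor A M) (p : mor M B) :
  short_exact a p -> at_least_constituents m A -> at_least_constituents n B ->
  at_least_constituents (m + n) M.
Proof.
move=> exM [lA [cA hA]] [lB [cB hB]]; exists (lB ++ lA).
split; first exact: comp_factors_ext exM cA cB.
by rewrite size_cat addnC leq_add.
Qed.

Hypothesis artC : artinian C.

Lemma at_least0 M : at_least_constituents 0 M.
Proof. by case: artC => _ /(_ M)[l cl]; exists l. Qed.

Lemma at_least1 M : ~ is_zero M -> at_least_constituents 1 M.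
Proof.
case: artC => _ /(_ M)[l cl] nzM; exists l; split=> //.
by case: cl nzM.
Qed.

(** When [y = m \oc p] is factored through its image [I], the restriction of [y] to [I] is
    [p \oc m], and [y^(l+1) = m (p m)^l p]. The kernel of [p] is nonzero, because a nilpotent
    monomorphism forces [M = 0]; so each passage to the image loses a constituent. *)
Lemma at_least_nilpotent M (y : mor M M) (N n : nat) :
  endo_pow y N = 0 -> endo_pow y n <> 0 -> at_least_constituents n.+1 M.
Proof.
elim: n M y => [|n IH] M y yN yn.
  by apply: at_least1 => /is_zero_idm.
have nzM : ~ is_zero M by move=> /(_ M)[h _]; apply: yn; apply: h.
have [I [p [m [ep mm mE]]]] := epi_mono_factor y.
have yS l : endo_pow y l.+1 = m \oc endo_pow (p \oc m) l \oc p.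
  elim: l => [|l IHl]; first by rewrite /endo_pow /= !comp_idr mE.
  by rewrite endo_powS IHl -{1}mE [in RHS]endo_powS !compA.
have [K [i ki]] := exists_kernel p.
rewrite -(add1n n.+1); apply: (at_least_ext (epi_short_exact ep ki)).
  apply: at_least1 => zK; apply: nzM.
  have mp : is_mono p.
    apply: mono_of_ker0 => D g pg0; have [h <-] := kernel_lift ki pg0.
    by rewrite (proj2 (zK D) h) compm0.
  have my : is_mono y by rewrite -mE; apply: mono_comp.
  apply/is_zero_idm; elim: (N) yN => [//|n1 IHN] yN.
  by apply: IHN; apply: (mono_eq0 my).
apply: (IH _ (p \oc m)).
  apply: (mono_eq0 mm); apply: (epi_eq0 ep); rewrite -yS endo_powS yN compm0 //.
by move=> y0; apply: yn; rewrite yS y0 compm0 comp0m.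
Qed.

(** [M] is an extension of [N i] by the kernel [K] of [prj i]. Orthogonality makes the other
    injections land in [K], and the biorthogonality relations restrict to [K]. *)
Lemma at_least_summands (I : eqType) (r : seq I) (N : I -> C) (n : I -> nat) M
    (inj : forall i, mor (N i) M) (prj : forall i, mor M (N i)) :
  uniq r -> (forall i, i \in r -> prj i \oc inj i = idm (N i)) ->
  (forall i j, i \in r -> j \in r -> i != j -> prj j \oc inj i = 0) ->
  (forall i, at_least_constituents (n i) (N i)) ->
  at_least_constituents (\sum_(i <- r) n i) M.
Proof.
move=> + + + hn; elim: r M inj prj => [|i r IH] M inj prj /= ur pi1 pi0.
  by rewrite big_nil; apply: at_least0.
have /andP[ir {}ur] := ur; rewrite big_cons addnC.
have ri j : j \in r -> j != i by move=> jr; apply: contraNneq ir => <-.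
have [K [u ku]] := exists_kernel (prj i).
have ei : is_epi (prj i) by apply: split_epi (pi1 i _); rewrite mem_head.
apply: (at_least_ext (epi_short_exact ei ku)) => //.
(* Outside [r] the lift is the dummy value 0, so that the lifts can be chosen as one function of
   [j]. *)
have lft j : exists h, j \in r -> u \oc h = inj j.
  have [jr|jr] := boolP (j \in r); last by exists 0.
  have [|h hE] := @kernel_lift _ _ _ _ _ _ (inj j) ku.
    by apply: pi0; rewrite ?mem_head ?inE ?jr ?orbT ?ri.
  by exists h.
pose inj' j := sval (cid (lft j)).
have inj'E j : j \in r -> u \oc inj' j = inj j by apply: (svalP (cid (lft j))).
apply: (IH K inj' (fun j => prj j \oc u)) => // [j jr|j l jr lr jl].
  by rewrite -compA inj'E // pi1 // inE jr orbT.
by rewrite -compA inj'E // pi0 // inE ?jr ?lr ?orbT.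
Qed.

Lemma exact_functor_epi (F : linfunctor C) A B (f : mor A B) :
  exact_functor F -> is_epi f -> is_epi (fmap F f).
Proof.
move=> exF ef; have [K [i ki]] := exists_kernel f.
by have [_ /cokernel_epi] := exF _ _ _ _ _ (epi_short_exact ef ki).
Qed.

End Abelian.

Section LinearFunctors.
Variable F : linfunctor C.

Lemma fmap0 A B : fmap F (0 : mor A B) = 0.
Proof.
have := fmap_lin F (-1) (0 : mor A B) 0.
by rewrite scaler0 addr0 scaleN1r addNr.
Qed.

Lemma fmapZ A B (a : k) (f : mor A B) : fmap F (a *: f) = a *: fmap F f.
Proof. by have := fmap_lin F a f 0; rewrite fmap0 !addr0. Qed.

End LinearFunctors.

End LinearCategories.

(** * Modules over affine Hecke algebras *)

Section HeckeModule.
Variables (k : fieldType) (q a : k) (L : lmodType k).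
Implicit Types (x y : {linear L -> L}) (f z : L).

Lemma iter_linear0 x n : iter n x 0 = 0.
Proof. by elim: n => //= n ->; rewrite linear0. Qed.

Lemma iter_linearD x n f z : iter n x (f + z) = iter n x f + iter n x z.
Proof. by elim: n => //= n ->; rewrite linearD. Qed.

Lemma iter_linearZ x n c f : iter n x (c *: f) = c *: iter n x f.
Proof. by elim: n => //= n ->; rewrite linearZ. Qed.

Lemma iter_commute (T : Type) (g h : T -> T) n t :
  (forall u, g (h u) = h (g u)) -> iter n g (h t) = h (iter n g t).
Proof. by move=> gh; elim: n => //= n ->. Qed.

Lemma iter_ge0 x m n f : (m <= n)%N -> iter m x f = 0 -> iter n x f = 0.
Proof. by move=> mn f0; rewrite -(subnK mn) iterD f0 iter_linear0. Qed.

(* If [x] and [y] were nilpotent on [z], so would be [b x + d y], which acts on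
   [z] as the nonzero scalar [c]. *)
Lemma nilpotent_comb_eq0 x y b d c N z :
  (forall f, x (y f) = y (x f)) -> c != 0 ->
  iter N x z = 0 -> iter N y z = 0 -> b *: x z + d *: y z = c *: z -> z = 0.
Proof.
move=> xy c0 xN yN cz.
(* Downward induction on the degree [i + j]: in degree [2N] one exponent is at least [N], and the
   relation expresses [c x^i y^j z] through monomials of degree [i + j + 1]. *)
suff H s : (s <= N + N)%N ->
    forall i j, (N + N - s <= i + j)%N -> iter i x (iter j y z) = 0.
  by have := H (N + N)%N (leqnn _) 0%N 0%N; apply; rewrite subnn.
have xiy i f : iter i x (y f) = y (iter i x f) by apply: iter_commute.
have xijy i j f : iter i x (iter j y f) = iter j y (iter i x f).
  elim: j => //= j IHj; by rewrite xiy IHj.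
elim: s => [_ i j hij|s IH hs i j hij].
  have [Ni|iN] := leqP N i; last first.
    by rewrite (@iter_ge0 y N j) ?iter_linear0 //; lia.
  by rewrite xijy (@iter_ge0 x N i) ?iter_linear0.
apply/eqP; move/eqP: c0 => /eqP c0; rewrite -(inj_eq (scalerI c0)) scaler0.
rewrite -!iter_linearZ -cz !iter_linearD !iter_linearZ.
have yx : iter j y (x z) = x (iter j y z) by apply: iter_commute => u; rewrite xy.
rewrite yx -iterSr -iterSr -[iter i.+1 x _]/(iter i.+1 x _).
by rewrite !IH ?scaler0 ?addr0 //; lia.
Qed.

(** For commuting [x] and [y] this is [(x^n - y^n) / (x - y)], the sum of the monomials [x^i y^j]
    with [i + j = n - 1], written without division. *)
Fixpoint divdiff x y n f : L :=
  if n is n'.+1 then x (divdiff x y n' f) + iter n' y f else 0.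

(** * Two positions: Bernstein relations and divided differences *)

Section TwoVariables.
Variables x y X Y T : {linear L -> L}.
Hypotheses (xE : forall f, x f = X f - a *: f) (yE : forall f, y f = Y f - a *: f).
Hypothesis xy : forall f, x (y f) = y (x f).
Hypothesis T_quad : forall f, T (T f) = (q - 1) *: T f + q *: f.
Hypothesis TYT : forall f, T (Y (T f)) = q *: X f.
Hypothesis q0 : q != 0.

Local Notation D := (divdiff x y).

Lemma divdiff_linear n c f z : D n (c *: f + z) = c *: D n f + D n z.
Proof.
elim: n => [|n IH] /=; first by rewrite scaler0 addr0.
by rewrite IH linearP iter_linearD iter_linearZ scalerDr addrACA.
Qed.

Lemma divdiff_commute (Z : {linear L -> L}) n f :
  (forall f, Z (x f) = x (Z f)) -> (forall f, Z (y f) = y (Z f)) ->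
  D n (Z f) = Z (D n f).
Proof.
move=> Zx Zy; elim: n => [|n IH] /=; first by rewrite linear0.
by rewrite IH linearD Zx (@iter_commute _ y Z).
Qed.

Lemma divdiffS n f : D n.+1 f = x (D n f) + iter n y f.
Proof. by []. Qed.

(** Comparison with [divdiffS] gives [(x - y) D n = x^n - y^n]. *)
Lemma divdiffSl n f : D n.+1 f = y (D n f) + iter n x f.
Proof.
elim: n => [|n IH]; first by rewrite /= !linear0.
by rewrite divdiffS [in LHS]IH (divdiffS n) !linearD xy -addrA [X in _ + X]addrC addrA.
Qed.

Lemma divdiff_add m n f : D (m + n) f = iter n x (D m f) + iter m y (D n f).
Proof.
elim: n => [|n IH]; first by rewrite addn0 /= iter_linear0 addr0.
rewrite addnS divdiffS IH linearD -iterS -addrA; congr (_ + _).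
rewrite divdiffS iter_linearD -iterD; congr (_ + _).
by rewrite (@iter_commute _ y x) // => u; rewrite xy.
Qed.

(** Applying [T] on the left of [T Y T = q X], reducing [T T] by the quadratic relation and
    cancelling [q] gives [T X = Y T + (q - 1) X]; the shifts by [a] agree on both sides. For
    [hecke_Ty] one multiplies on the right instead. *)
Lemma hecke_Tx f : T (x f) = y (T f) + (q - 1) *: X f.
Proof.
rewrite xE yE linearB linearZ /= addrAC; congr (_ - _).
apply: (scalerI q0); have h := T_quad (Y (T f)).
rewrite TYT linearZ /= in h; rewrite h scalerDr [RHS]addrC.
by rewrite !scalerA [q * _]mulrC.
Qed.

Lemma hecke_Ty f : T (y f) = x (T f) - (q - 1) *: X f.
Proof.
have h := TYT (T f); rewrite T_quad !linearD !linearZ /= TYT in h.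
have {}h : q *: T (Y f) = q *: (X (T f) - (q - 1) *: X f).
  by rewrite scalerBr -h scalerA mulrC -scalerA addrAC subrr add0r.
move/(scalerI q0): h => h.
by rewrite xE yE linearB linearZ /= h addrAC.
Qed.

Let xX f : X f = x f + a *: f. Proof. by rewrite xE subrK. Qed.

Let Xy f : X (y f) = y (X f).
Proof. by rewrite !xX linearD linearZ /= xy. Qed.

Lemma hecke_Tx_iter n f : T (iter n x f) = iter n y (T f) + (q - 1) *: X (D n f).
Proof.
elim: n => [|n IH]; first by rewrite /= !linear0 addr0.
rewrite [iter n.+1 x f]/= hecke_Tx IH divdiffSl !linearD /= -addrA; congr (_ + _).
by rewrite linearZ Xy.
Qed.

Lemma hecke_Ty_iter n f : T (iter n y f) = iter n x (T f) - (q - 1) *: X (D n f).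
Proof.
elim: n => [|n IH]; first by rewrite /= !linear0 addr0.
rewrite [iter n.+1 y f]/= hecke_Ty IH linearB linearZ /= -addrA; congr (_ + _).
rewrite -opprD -scalerDr; congr (- (_ *: _)).
by rewrite linearD; congr (_ + _); rewrite !xX linearD linearZ.
Qed.

(** [D n] is a symmetric polynomial in [x] and [y], and such polynomials commute with [T]: here the
    corrections produced by [T x] and by [T y^n] cancel. *)
Lemma hecke_T_divdiff n f : T (D n f) = D n (T f).
Proof.
elim: n => [|n IH]; first by rewrite /= linear0.
rewrite divdiffS linearD hecke_Tx hecke_Ty_iter.
by rewrite addrACA subrr addr0 IH -divdiffSl.
Qed.

Let Xx f : X (x f) = x (X f).
Proof. by rewrite !xX linearD linearZ. Qed.

Let yY f : Y f = y f + a *: f. Proof. by rewrite yE subrK. Qed.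

Lemma iter_divdiff (z : {linear L -> L}) N n f :
  (forall u, z (x u) = x (z u)) -> (forall u, z (y u) = y (z u)) ->
  iter N z (D n f) = D n (iter N z f).
Proof.
by move=> zx zy; apply: (@iter_commute _ z (D n)) => u; rewrite divdiff_commute.
Qed.

Lemma divdiff_nilpotent N f : iter N x f = 0 -> iter N y f = 0 -> D (N + N) f = 0.
Proof.
have D0 : D N 0 = 0.
  by have := divdiff_linear N (-1) 0 0; rewrite scaler0 addr0 scaleN1r addNr.
move=> xN yN; rewrite divdiff_add !iter_divdiff ?xN ?yN ?D0 ?addr0 //.
Qed.

(** [x^(2N) T f] is [T y^(2N) f + (q - 1) X D f] with [D = D (N + N)], and every monomial of that
    [D], of degree [2N - 1], contains [x^N] or [y^N]. This is why the exponent doubles. *)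
Lemma hecke_T_nilpotent N f : iter N x f = 0 -> iter N y f = 0 ->
  iter (N + N) x (T f) = 0 /\ iter (N + N) y (T f) = 0.
Proof.
move=> xN yN; have hD := divdiff_nilpotent xN yN.
have leN : (N <= N + N)%N by apply: leq_addr.
have := hecke_Tx_iter (N + N) f; have := hecke_Ty_iter (N + N) f.
rewrite hD !linear0 (iter_ge0 leN xN) (iter_ge0 leN yN) !linear0.
by rewrite !addr0.
Qed.

Hypotheses (a0 : a != 0) (q1 : q != 1).

(* For [f] killed by a power of [x] and of [y], the identity
   [(T + 1) x^m (T - q) = (q X - Y) D m (T - q)], in which [q X - Y] is
   invertible, shows that [T] acts by [q] on [D m W]; comparing [T X] with
   [q X] then gives [X - q Y = 0] there. *)
Lemma divdiff_eq0 (W : L -> Prop) m :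
  is_subspace W ->
  (forall f, W f -> [/\ W (X f), W (Y f) & W (T f)]) ->
  (forall f, W f -> exists N, iter N x f = 0 /\ iter N y f = 0) ->
  (forall f, W f -> iter m x f = 0) ->
  forall f, W f -> D m f = 0.
Proof.
move=> [W0 WD] Wst Wnil xm0.
have c0 : (q - 1) * a != 0 by rewrite mulf_neq0 // subr_eq0.
have WX f : W f -> W (X f) by case/Wst.
have WY f : W f -> W (Y f) by case/Wst.
have WT f : W f -> W (T f) by case/Wst.
have WZ c f : W f -> W (c *: f) by move=> Wf; have := WD c f 0 Wf W0; rewrite addr0.
have WB c f g : W f -> W g -> W (f - c *: g).
  by move=> Wf Wg; rewrite -scaleNr addrC; apply: WD.
have WxX f : W f -> W (x f) by move=> Wf; rewrite xE; apply: WB => //; apply: WX.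
have Wy f : W f -> W (y f) by move=> Wf; rewrite yE; apply: WB => //; apply: WY.
have Wyn n f : W f -> W (iter n y f).
  by move=> Wf; elim: n => //= n IH; apply: Wy.
have WDn n f : W f -> W (D n f).
  move=> Wf; elim: n => //= n IH; rewrite -[_ + _]addr0 -[X in _ + X](scaler0 _ (-1)).
  have := WD 1 _ _ (WxX _ IH) (Wyn n _ Wf); by rewrite scale1r scaler0 addr0.
have DT f : W f -> D m (T f - q *: f) = 0.
  move=> Wf; set g := T f - q *: f.
  have Wg : W g by apply: WB => //; apply: WT.
  have Tg : T g = - g.
    rewrite /g linearB linearZ /= T_quad opprB scalerBl scale1r.
    by rewrite addrAC [_ - _ - _]addrAC subrr add0r addrC.
  have := hecke_Tx_iter m g.
  rewrite (xm0 _ Wg) linear0 Tg => /esym.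
  have := divdiffSl m g; rewrite divdiffS (xm0 _ Wg) addr0 => hy.
  have -> : iter m y (- g) = - (y (D m g) - x (D m g)).
    rewrite -hy addrAC subrr add0r; elim: (m) => //= n ->; exact: linearN.
  rewrite opprB => h.
  have [N [xN yN]] := Wnil _ (WDn m _ Wg).
  (* In terms of [x = X - a] and [y = Y - a], the equation [(q X - Y) z = 0] reads
     [- q x z + y z = (q - 1) a z]. *)
  apply: (@nilpotent_comb_eq0 x y (- q) 1 ((q - 1) * a) N) => //.
  move: h; rewrite xX scalerDr scalerA scalerBl !scale1r addrA.
  rewrite [_ - _ + (_ - _)]addrC addrA subrK addrC => h.
  by apply/esym/eqP; rewrite -subr_eq0 scaleNr opprD opprK h.
have {}DT f : W f -> T (D m f) = q *: D m f.
  move=> Wf; have := DT f Wf.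
  rewrite -scaleNr addrC divdiff_linear -hecke_T_divdiff scaleNr => /eqP.
  by rewrite addrC subr_eq0 => /eqP.
move=> f Wf; have [N [xN yN]] := Wnil _ (WDn m _ Wf).
have DX : D m (X f) = X (D m f).
  apply: divdiff_commute => u; first exact: Xx.
  exact: Xy.
have TX : T (X (D m f)) = q *: X (D m f).
  by rewrite -DX; apply: DT; apply: WX.
have Xd : X (D m f) - q *: Y (D m f) = 0.
  have := hecke_Tx (D m f); rewrite xE linearB TX linearZ /= DT //.
  rewrite yE [Y (q *: _)]linearZ /= scalerBl scale1r.
  move/eqP; rewrite -subr_eq0 opprD !opprB addrA subrKA addrC subrKA.
  exact: eqP.
apply: (@nilpotent_comb_eq0 x y 1 (- q) ((q - 1) * a) N) => //.
apply/eqP; rewrite -subr_eq0 -Xd xX yY; apply/eqP.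
rewrite scale1r scaleNr mulrBl mul1r scalerBl scalerDr scalerA.
by rewrite opprB opprD addrACA [- _ + _]addrC !addrA.
Qed.

End TwoVariables.

(** * Affine Hecke relations on [n] positions *)

Record hecke_action n (X T : nat -> {linear L -> L}) : Prop := HeckeAction {
  hecke_quad : forall j f, (j.+1 < n)%N -> T j (T j f) = (q - 1) *: T j f + q *: f;
  hecke_TXT : forall j f, (j.+1 < n)%N -> T j (X j.+1 (T j f)) = q *: X j f;
  hecke_XX : forall i j f, (i < n)%N -> (j < n)%N -> X i (X j f) = X j (X i f);
  hecke_TX : forall i j f, (i < n)%N -> (j.+1 < n)%N -> i != j -> i != j.+1 ->
    T j (X i f) = X i (T j f)
}.

Definition shift_by (Z : {linear L -> L}) (f : L) : L := Z f - a *: f.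

Fact shift_by_is_linear Z : linear (shift_by Z).
Proof.
move=> c f g; rewrite /shift_by linearP scalerDr opprD addrACA scalerBr.
by rewrite !scalerA mulrC.
Qed.

HB.instance Definition _ Z := GRing.isLinear.Build k L L *:%R (shift_by Z)
  (shift_by_is_linear Z).

Lemma shift_byC (Z Z' : {linear L -> L}) f :
  Z (Z' f) = Z' (Z f) -> Z (shift_by Z' f) = shift_by Z' (Z f).
Proof. by move=> h; rewrite /shift_by linearB linearZ /= h. Qed.

Definition gen_eigen n (X : nat -> {linear L -> L}) (f : L) : Prop :=
  forall j, (j < n)%N -> exists N, iter N (shift_by (X j)) f = 0.

Lemma gen_eigen_subspace n X : is_subspace (gen_eigen n X).
Proof.
split=> [j _|c f g hf hg j jn]; first by exists 0%N.
have [[N hN] [M hM]] := (hf j jn, hg j jn).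
exists (N + M)%N; rewrite iter_linearD iter_linearZ.
by rewrite (iter_ge0 _ hN) ?(iter_ge0 _ hM) ?scaler0 ?addr0 ?leq_addr ?leq_addl.
Qed.

Lemma gen_eigen_X n X T i f : hecke_action n X T -> (i < n)%N ->
  gen_eigen n X f -> gen_eigen n X (X i f).
Proof.
move=> hX ilt hf j jn; have [N hN] := hf j jn; exists N.
have -> : iter N (shift_by (X j)) (X i f) = X i (iter N (shift_by (X j)) f).
  by apply: iter_commute => u; rewrite shift_byC //; apply: (hecke_XX hX).
by rewrite hN linear0.
Qed.

Lemma shift_by_comm (Z Z' : {linear L -> L}) f :
  (forall f, Z (Z' f) = Z' (Z f)) ->
  shift_by Z (shift_by Z' f) = shift_by Z' (shift_by Z f).
Proof.
move=> h; rewrite {1}/shift_by shift_byC // -linearZ -linearB.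
by [].
Qed.

Hypotheses (q0 : q != 0) (q1 : q != 1) (a0 : a != 0).

(** [T i] commutes with [X j] except for [j = i] and [j = i.+1], where [hecke_T_nilpotent] applies
    with a common exponent. *)
Lemma gen_eigen_T n X T i f : hecke_action n X T -> (i.+1 < n)%N ->
  gen_eigen n X f -> gen_eigen n X (T i f).
Proof.
move=> hX ilt hf j jn; have ilt' := ltnW ilt.
have [N hN] := hf _ ilt'; have [M hM] := hf _ ilt.
have [] := @hecke_T_nilpotent (shift_by (X i)) (shift_by (X i.+1)) (X i) (X i.+1)
  (T i) _ _ _ _ _ _ (N + M)%N f.
- by [].
- by [].
- by move=> u; apply: shift_by_comm => v; apply: (hecke_XX hX).
- by move=> u; apply: (hecke_quad hX).
- by move=> u; apply: (hecke_TXT hX).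
- by [].
- exact: iter_ge0 (leq_addr _ _) hN.
- exact: iter_ge0 (leq_addl _ _) hM.
move=> hi hi1.
have [->|ji] := eqVneq j i; first by exists (N + M + (N + M))%N.
have [->|ji1] := eqVneq j i.+1; first by exists (N + M + (N + M))%N.
have [P hP] := hf j jn; exists P.
have -> : iter P (shift_by (X j)) (T i f) = T i (iter P (shift_by (X j)) f).
  by apply: iter_commute => u; rewrite shift_byC //; apply: (hecke_TX hX).
by rewrite hP linear0.
Qed.

(* Induction on [m]: on [W] the divided difference [D m] of [x_0] and [x_1]
   vanishes, hence [x_1 ^ m.-1] vanishes on [W :&: ker x_0], on which the
   generators other than [X_0] and [T_0] act; so [x_0] is injective on [W]. *)
Lemma hecke_module_eq0 m n (X T : nat -> {linear L -> L}) (W : L -> Prop) :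
  (m < n)%N -> hecke_action n X T -> is_subspace W ->
  (forall j f, (j < n)%N -> W f -> W (X j f)) ->
  (forall j f, (j.+1 < n)%N -> W f -> W (T j f)) ->
  (forall f, W f -> gen_eigen n X f) ->
  (forall f, W f -> iter m (shift_by (X 0%N)) f = 0) ->
  forall f, W f -> f = 0.
Proof.
elim: m n X T W => [|m IH] n X T W; first by move=> _ _ _ _ _ _; apply.
case: n => [|[|n]] // mn hX sW WX WT Wnil xm0.
set x := shift_by (X 0%N) in xm0; set y := shift_by (X 1%N).
have hD f : W f -> divdiff x y m.+1 f = 0.
  apply: (@divdiff_eq0 x y (X 0%N) (X 1%N) (T 0%N)) => //.
  - by move=> u; apply: shift_by_comm => v; apply: (hecke_XX hX).
  - by move=> u; apply: (hecke_quad hX).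
  - by move=> u; apply: (hecke_TXT hX).
  - by move=> u Wu; split; [apply: WX|apply: WX|apply: WT].
  - move=> u Wu; have [N hN] := Wnil _ Wu 0%N erefl.
    have [M hM] := Wnil _ Wu 1%N erefl; exists (N + M)%N.
    by split; [apply: iter_ge0 (leq_addr _ _) hN|apply: iter_ge0 (leq_addl _ _) hM].
have xinj f : W f -> x f = 0 -> f = 0.
  move=> Wf xf; apply: (IH n.+1 (fun j => X j.+1) (fun j => T j.+1)
      (fun u => W u /\ x u = 0)) => //.
  - split=> *.
    + by apply: (hecke_quad hX).
    + by apply: (hecke_TXT hX).
    + by apply: (hecke_XX hX).
    + by apply: (hecke_TX hX).
  - case: sW => W0 WD; split=> [|c u v [Wu xu] [Wv xv]]; first by rewrite /x linear0.
    split; first exact: WD.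
    by rewrite /x in xu xv *; rewrite linearP /= xu xv scaler0 addr0.
  - move=> j u jn [Wu xu]; split; first exact: WX.
    by rewrite /x in xu *; rewrite -shift_byC /= ?xu ?linear0 //; apply: (hecke_XX hX).
  - move=> j u jn [Wu xu]; split; first exact: WT.
    by rewrite /x in xu *; rewrite -shift_byC /= ?xu ?linear0 //; apply: (hecke_TX hX).
  - by move=> u [Wu _] j jn; apply: Wnil Wu j.+1 jn.
  (* [x] commutes with [divdiff x y m], so on the kernel of [x] only the term [y^m u] of
     [divdiff x y m.+1 u] survives. *)
  - move=> u [Wu xu]; have := hD u Wu.
    rewrite divdiffS -(@divdiff_commute _ _ (shift_by (X 0%N))) //.
      rewrite /= -/x xu; have := divdiff_linear x y m (-1) 0 0.
      by rewrite scaler0 addr0 scaleN1r addNr => ->; rewrite add0r.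
    by move=> v; apply: shift_by_comm => w; apply: (hecke_XX hX).
move=> f Wf; have := xm0 f Wf; elim: m.+1 => [//|l IHl] /= h.
apply: IHl; apply: xinj h; elim: l => //= l IHl.
rewrite /x /shift_by; case: sW => W0 WD; rewrite addrC -scaleNr.
by apply: WD => //; apply: WX.
Qed.

End HeckeModule.

(** * Strings in crystals of multipartitions *)

Fixpoint has_string (X : Type) (edge : X -> X -> Prop) n (x : X) : Prop :=
  if n is n'.+1 then exists2 y, edge x y & has_string edge n' y else True.

Section Signatures.
Local Open Scope nat_scope.
Implicit Types (x y : node * bool) (w : seq (node * bool)) (z : node).

Definition push x w : seq (node * bool) :=
  if x.2 then x :: w
  else if w is y :: w' then if y.2 then w' else x :: w else [:: x].

(** The reduced word computed in one pass from the lowest node upwards, kept as a stack. This form,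
    unlike iterated deletion, lends itself to induction on the word. *)
Definition cancel_pairs w : seq (node * bool) := foldr push [::] w.

Definition plus_nodes w : seq node := [seq x.1 | x <- w & x.2].

Definition not_minus_plus x y := x.2 || ~~ y.2.

Lemma cancel_pairs_sorted w : sorted not_minus_plus (cancel_pairs w).
Proof.
elim: w => //= x w; case: (cancel_pairs w) => [|y v] /=; rewrite /push.
  by case: ifP.
move=> hv; case: ifP => [x2|x2] /=; first by rewrite /not_minus_plus x2.
case: ifP => y2 /=; last by rewrite /not_minus_plus y2 orbT.
by case: v hv => //= t u /andP[].
Qed.

Lemma cancel_pairs_id w : sorted not_minus_plus w -> cancel_pairs w = w.
Proof.
elim: w => //= x w IH; case: w IH => [|y w] /= IH.
  by rewrite /push; case: ifP.
move=> /andP[xy hw]; rewrite IH // /push; case: ifP => //.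
by move: xy; rewrite /not_minus_plus => /[swap] -> /= /negPf ->.
Qed.

Lemma cancel_pairs_delete w : cancel_pairs (delete_pair w) = cancel_pairs w.
Proof.
elim: w => //= x [//|y w] IH; case: ifP => [/andP[x2 y2]|_]; last by rewrite /= IH.
by rewrite /= /push y2 (negPf x2) y2.
Qed.

Lemma delete_pair_id w : sorted not_minus_plus w -> delete_pair w = w.
Proof.
elim: w => //= x [//|y w] IH /= /andP[xy hw].
case: ifP => h; last by congr (x :: _); apply: IH.
by move: xy h; rewrite /not_minus_plus; case: x.2; case: y.2.
Qed.

Lemma size_delete_pair w :
  ~~ sorted not_minus_plus w -> size (delete_pair w) < size w.
Proof.
elim: w => //= x [//|y w] IH /=; rewrite negb_and.
case: ifP => [_ _|h /orP[xy|/IH hw]]; first by rewrite ltnS leqW.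
  by move: h xy; rewrite /not_minus_plus; case: x.2; case: y.2.
exact: hw.
Qed.

Lemma iter_delete_pair_sorted n w :
  size w <= n -> sorted not_minus_plus (iter n delete_pair w).
Proof.
elim: n w => [|n IH] w; first by rewrite leqn0 => /nilP ->.
rewrite iterSr => hw; have [sw|nsw] := boolP (sorted not_minus_plus w).
  by rewrite delete_pair_id //; elim: (n) => //= m hm; rewrite delete_pair_id.
by apply: IH; have := size_delete_pair nsw; lia.
Qed.

(** Deleting a pair does not change [cancel_pairs], which fixes reduced words; and [size w]
    deletions suffice, since each one shortens a word that is not yet reduced. *)
Lemma iter_delete_pairE w : iter (size w) delete_pair w = cancel_pairs w.
Proof.
rewrite -(cancel_pairs_id (iter_delete_pair_sorted (leqnn _))).
by elim: (size w) => //= n IH; rewrite cancel_pairs_delete.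
Qed.

Definition unmatched w := plus_nodes (cancel_pairs w).

(** A reduced word is a block of pluses followed by a block of minuses. A new minus in front
    therefore cancels the first unmatched plus, or meets a word without any plus. *)
Lemma unmatched_cons x w :
  unmatched (x :: w) =
    if x.2 then x.1 :: unmatched w else behead (unmatched w).
Proof.
rewrite /unmatched /= {1}/push; case: ifP => x2; first by rewrite /plus_nodes /= x2.
have := cancel_pairs_sorted w; case: (cancel_pairs w) => [|y v] /=.
  by rewrite /plus_nodes /= x2.
rewrite /plus_nodes; case: ifP => y2 /=; first by rewrite y2.
rewrite x2 y2 /= => hv.
have tr : transitive not_minus_plus.
  by move=> a b c; rewrite /not_minus_plus; case: a.2; case: b.2; case: c.2.
have : all (fun z : node * bool => ~~ z.2) v.
  apply: sub_all (order_path_min tr hv) => z.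
  by rewrite /not_minus_plus y2.
move=> /allP v2; suff -> : [seq t <- v | t.2] = [::] by [].
by rewrite (@eq_in_filter _ _ pred0) ?filter_pred0 // => t /v2/negPf.
Qed.

Lemma unmatched_sub w z : z \in unmatched w -> (z, true) \in w.
Proof.
elim: w => // x w IH; rewrite unmatched_cons; case: ifP => x2.
  rewrite inE => /orP[/eqP ->|/IH zw]; last by rewrite inE zw orbT.
  by case: x x2 => a b /= ->; rewrite mem_head.
by move=> /mem_behead/IH zw; rewrite inE zw orbT.
Qed.

Definition flip z w := [seq (y.1, y.2 && (y.1 != z)) | y <- w].

Lemma flip_id z w : z \notin map fst w -> flip z w = w.
Proof.
elim: w => //= -[a b] w IH; rewrite inE negb_or => /andP[za /IH ->] /=.
by rewrite eq_sym za andbT.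
Qed.

(** Every plus lower than [z] is already matched, so the new minus at [z] cancels nothing. The
    minuses above [z] remove entries from the front of the unmatched list, away from [z]. *)
Lemma unmatched_flip w p z : uniq (map fst w) ->
  unmatched w = rcons p z -> unmatched (flip z w) = p.
Proof.
elim: w p => [|x w IH] p; first by case: p.
rewrite [map _ _]/= [uniq _]/= => /andP[xw uw].
have neq q : unmatched w = rcons q z -> x.1 != z.
  move=> h; apply: contraNneq xw => ->.
  have : z \in unmatched w by rewrite h mem_rcons mem_head.
  by move=> /unmatched_sub/(map_f fst).
rewrite [flip _ _]/= !unmatched_cons /=; case: x.2 (xw) => /= xw'.
  case E: (unmatched w) / lastP => [|q y].
    case: p => [[xz]|b [|b1 p]] //=.
    by rewrite -xz eqxx /= flip_id // E.
  rewrite -rcons_cons => /rcons_inj[<- yz]; rewrite yz in E.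
  by rewrite (neq _ E) (IH _ uw E).
case E: (unmatched w) => [|y q] /= hq; first by case: (p) hq.
have {}E : unmatched w = rcons (y :: p) z by rewrite E hq.
by rewrite (IH _ uw E).
Qed.

Lemma unmatched_size w :
  count snd w <= size (unmatched w) + count (fun x => ~~ x.2) w.
Proof.
elim: w => // x w IH; rewrite unmatched_cons /=; case: x.2 => /=; first by lia.
by rewrite size_behead; lia.
Qed.

End Signatures.

(** * Addable and removable nodes, and the signature after adding a node *)

Section Multipartitions.
Local Open Scope nat_scope.
Implicit Types (lam : seq (seq nat)).

Lemma is_partition_le p a : is_partition p -> nth 0 p a.+1 <= nth 0 p a.
Proof.
move=> /andP[/(sortedP 0) h _]; have [/h //|lt] := ltnP a.+1 (size p).
by rewrite nth_default.
Qed.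

Lemma is_partition_gt0 p a : is_partition p -> (0 < nth 0 p a) = (a < size p).
Proof.
move=> /andP[_ h]; have [ap|ap] := ltnP a (size p); last by rewrite nth_default.
by rewrite lt0n; apply: contraNneq h => <-; apply: mem_nth.
Qed.

Lemma is_partition_incr p a : is_partition p ->
  (a == 0) || (nth 0 p a < nth 0 p a.-1) -> is_partition (incr_nth p a).
Proof.
move=> hp ha; apply/andP; split.
  apply/(sortedP 0) => j _; rewrite /geq /= !nth_incr_nth.
  have := is_partition_le j hp; case: (eqVneq a j.+1) ha => [->|_] /=; lia.
apply/negP => /(nthP 0)[j]; rewrite size_incr_nth nth_incr_nth.
have := is_partition_gt0 j hp; have := is_partition_gt0 a.-1 hp.
by case: ifP; case: eqVneq ha => /=; lia.
Qed.

Lemma is_partition_nth r lam c : is_multipartition r lam -> is_partition (nth [::] lam c).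
Proof.
move=> /andP[_ /allP h]; have [/(mem_nth [::])/h //|lt] := ltnP c (size lam).
by rewrite nth_default.
Qed.

Arguments is_partition_nth [r lam] c _.

Lemma row_len_le r lam c a : is_multipartition r lam ->
  row_len lam c a.+1 <= row_len lam c a.
Proof. by move=> h; apply: is_partition_le (is_partition_nth _ h). Qed.

Lemma row_len_add lam a b c c' a' : c < size lam ->
  row_len (add_node lam (a, b, c)) c' a' =
  row_len lam c' a' + ((c' == c) && (a' == a)).
Proof.
move=> hc; rewrite /row_len /= nth_set_nth /=.
case: eqVneq => [->|_] /=; last by rewrite addn0.
by rewrite nth_incr_nth addnC eq_sym.
Qed.

Lemma size_add_node lam a b c : c < size lam ->
  size (add_node lam (a, b, c)) = size lam.
Proof. by move=> hc; rewrite /= size_set_nth; apply/maxn_idPr. Qed.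

Lemma is_multipartition_add r lam z : is_multipartition r lam ->
  addable lam z -> is_multipartition r (add_node lam z).
Proof.
move: z => [[a b] c] hl /and3P[hc _ ha]; have /andP[/eqP rl hall] := hl.
rewrite /is_multipartition size_add_node // rl eqxx /=.
apply/allP => p /(nthP [::])[j]; rewrite size_set_nth (maxn_idPr hc) => hj <-.
rewrite nth_set_nth /=; case: eqVneq => _; last by apply: (is_partition_nth _ hl).
by apply: is_partition_incr => //; apply: (is_partition_nth _ hl).
Qed.

Lemma big_flatten (R I : Type) (idx : R) (op : Monoid.law idx)
    (ss : seq (seq I)) (F : I -> R) :
  \big[op/idx]_(i <- flatten ss) F i =
    \big[op/idx]_(t <- ss) \big[op/idx]_(i <- t) F i.
Proof.
by elim: ss => [|t ss IH]; rewrite ?big_nil // big_cons /= big_cat IH.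
Qed.

Lemma flatten_bigcat (T : Type) (ss : seq (seq T)) :
  flatten ss = \big[cat/[::]]_(t <- ss) t.
Proof. by elim: ss => [|t ss IH]; rewrite ?big_nil // big_cons /= IH. Qed.

Variables (e : nat) (s : seq 'I_e).

(** The addable node comes first because a larger column is higher. In an empty row [l.-1] is 0, but
    [removable] then fails, as it asks for [1 = 0]. *)
Definition row_sig (i : 'I_e) lam (c a : nat) : seq (node * bool) :=
  let l := row_len lam c a in
  nseq (addable lam (a, l, c) && residue_is s i (a, l, c)) ((a, l, c), true) ++
  nseq (removable lam (a, l.-1, c) && residue_is s i (a, l.-1, c))
    ((a, l.-1, c), false).

Local Arguments addable : simpl never.
Local Arguments removable : simpl never.
Local Arguments residue_is : simpl never.

Lemma row_sigE i lam c a :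
  [seq (x, addable lam x)
     | x <- [seq (a, b, c) | b <- rev (iota 0 (row_len lam c a).+1)]
     & (addable lam x || removable lam x) && residue_is s i x]
  = row_sig i lam c a.
Proof.
rewrite /row_sig; set P := fun x => _ && _; set l := row_len lam c a.
have remE b : removable lam (a, b, c) -> b.+1 = l by case/andP => /eqP.
have addE b : addable lam (a, b, c) -> b = l by case/and3P => _ /eqP.
have small m : m < l -> [seq x <- [seq (a, b, c) | b <- rev (iota 0 m)] | P x] = [::].
  move=> ml; apply/eqP; rewrite -size_eq0 size_filter -leqn0 leqNgt -has_count.
  apply/hasPn => y /mapP[b]; rewrite mem_rev mem_iota add0n => /= bm ->.
  rewrite /P negb_and; apply/orP; left; apply/norP.
  by split; apply/negP; [move=> /addE|move=> /remE]; lia.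
have mapE z (b v : bool) : (b -> addable lam z = v) ->
    [seq (x, addable lam x) | x <- if b then [:: z] else [::]] = nseq b (z, v).
  by case: b => // /(_ isT) <-.
rewrite -addn1 iotaD rev_cat map_cat filter_cat map_cat /= add0n.
congr (_ ++ _).
  have -> : P (a, l, c) = addable lam (a, l, c) && residue_is s i (a, l, c).
    rewrite /P; case: (boolP (removable _ _)) => [/remE|_]; first by lia.
    by rewrite orbF.
  by apply: mapE => /andP[].
case El: l => [|m].
  by case: (boolP (removable _ _)) => // /remE; rewrite El.
rewrite -addn1 iotaD rev_cat map_cat filter_cat small ?El //= cats0 add0n addn1.
have -> : P (a, m, c) = removable lam (a, m, c) && residue_is s i (a, m, c).
  by rewrite /P; case: (boolP (addable _ _)) => [/addE|_] //; lia.
by apply: mapE => _; apply/negbTE/negP => /addE; lia.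
Qed.

Lemma row_sig_nil i lam c a : size (nth [::] lam c) < a -> row_sig i lam c a = [::].
Proof.
case: a => // a h; have h1 : row_len lam c a.+1 = 0 by rewrite /row_len nth_default // ltnW.
have h0 : row_len lam c a = 0 by rewrite /row_len nth_default.
by rewrite /row_sig /addable /removable /= h1 h0 /= !andbF.
Qed.

(** Any sufficiently large [M] is allowed, so that the signatures of [lam] and of [add_node lam z]
    can be compared row by row over the same range. *)
Lemma signatureE i lam M : (forall c, size (nth [::] lam c) < M) ->
  signature s i lam =
    \big[cat/[::]]_(c <- iota 0 (size lam)) \big[cat/[::]]_(a <- iota 0 M)
      row_sig i lam c a.
Proof.
move=> hM; rewrite /signature /candidate_nodes map_allpairs.
rewrite filter_flatten map_flatten -map_comp flatten_bigcat !big_map.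
rewrite big_flatten big_map; apply: eq_bigr => c _.
rewrite big_map; have := hM c; set n := size _ => nM.
rewrite -(subnKC nM) iotaD big_cat /= [X in _ = _ ++ X]big1_seq ?cats0.
  by apply: eq_bigr => a _; apply: row_sigE.
move=> a /=; rewrite mem_iota => /andP[h _]; apply: row_sig_nil.
by move: h; rewrite add0n.
Qed.

Lemma row_bound lam : exists M, forall c, size (nth [::] lam c) < M.
Proof.
exists (\max_(p <- lam) size p).+1 => c; rewrite ltnS.
have [h|h] := ltnP c (size lam); last by rewrite nth_default.
by rewrite (big_nth [::]) big_mkord (leq_bigmax (Ordinal h)).
Qed.

Lemma signature_mem i lam z : (z, true) \in signature s i lam ->
  addable lam z /\ residue_is s i z.
Proof.
by move=> /mapP[y]; rewrite mem_filter => /andP[/andP[_ hy] _] [-> <-].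
Qed.

Lemma signature_uniq i lam : uniq (map fst (signature s i lam)).
Proof.
rewrite -map_comp map_id; apply: filter_uniq; rewrite map_inj_uniq; last first.
  by move=> [[c a] b] [[c' a'] b'] /= [-> -> ->].
apply: allpairs_uniq_dep.
- apply: allpairs_uniq_dep => [|? _|[? ?] [? ?] _ _ /= [-> ->] //]; exact: iota_uniq.
- by move=> ? _; rewrite rev_uniq iota_uniq.
- by move=> [? ?] [? ?] _ _ /= [-> ->].
Qed.

Lemma residue_adjacent i a b c a' b' : 2 <= e ->
  residue_is s i (a, b, c) -> a' + b = (a + b').+1 \/ (a' + b).+1 = a + b' ->
  residue_is s i (a', b', c) = false.
Proof.
move=> e2 hi hab; apply/negP; move: hi; rewrite /residue_is !eqz_mod_dvd => h h'.
have := rpredB h h'; rewrite dvdzE; set d := (_ - _)%R.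
have [->|->] : d = 1%R \/ d = (-1)%R by rewrite /d; lia.
  by rewrite dvdn1 => /eqP; lia.
by rewrite dvdn1 => /eqP; lia.
Qed.

(** Besides [z = (a, b, c)], adding it can change the status only of its neighbours [(a, b.+1)],
    [(a.+1, b)], [(a, b.-1)] and [(a.-1, b)]. They lie on adjacent diagonals, so for [e >= 2] their
    residue is not [i]. *)
Lemma row_sig_add r i lam z c' a' : 2 <= e -> is_multipartition r lam ->
  addable lam z -> residue_is s i z ->
  row_sig i (add_node lam z) c' a' = flip z (row_sig i lam c' a').
Proof.
move: z => [[a b] c] e2 hl /[dup] adz /and3P[hc /eqP bE hlt] rz.
have adj := residue_adjacent e2 rz.
rewrite /row_sig row_len_add //.
have [/andP[/eqP-> /eqP->]|ne] := boolP ((c' == c) && (a' == a)).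
  rewrite -bE adz rz addn1 /= adj ?andbF /=; last by lia.
  have -> : removable lam (a, b.-1, c) && residue_is s i (a, b.-1, c) = false.
    apply/negP => /andP[/andP[/eqP hb _]]; rewrite -bE in hb.
    by rewrite adj //; lia.
  have -> : removable (add_node lam (a, b, c)) (a, b, c) && residue_is s i (a, b, c).
    rewrite rz andbT /removable !row_len_add // !eqxx /= -bE addn1 eqxx.
    have := row_len_le c a hl; rewrite -bE; case: eqVneq => [|_]; lia.
  by rewrite /flip /= eqxx.
rewrite addn0 flip_id; last first.
  rewrite map_cat !map_nseq mem_cat !mem_nseq.
  by apply: contraNN ne => /orP[]/andP[_ /eqP[-> _ ->]]; rewrite !eqxx.
set l := row_len lam c' a'; congr (nseq _ _ ++ nseq _ _).
  rewrite /addable size_add_node // row_len_add // (negPf ne) addn0 -/l.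
  case: a' @l ne => // a' l ne; rewrite row_len_add //=.
  case: (eqVneq c' c) ne => [cE|_] ne; last by rewrite addn0.
  case: (eqVneq a' a) => [aE|_]; last by rewrite addn0.
  rewrite cE aE -bE; have [lb|lb] := eqVneq l b; last by congr (_ && _); lia.
  by rewrite lb adj ?andbF //; lia.
rewrite /removable !row_len_add // (negPf ne) addn0 -/l.
case: (eqVneq c' c) ne => [cE|_] ne; last by rewrite addn0.
case: (eqVneq a'.+1 a) => [aE|_]; last by rewrite addn0.
rewrite cE aE -bE /=; have [lb|lb] := eqVneq l b.+1; last by congr (_ && _); lia.
by rewrite lb adj ?andbF //; lia.
Qed.

Lemma signature_add r i lam z : 2 <= e -> is_multipartition r lam ->
  addable lam z -> residue_is s i z ->
  signature s i (add_node lam z) = flip z (signature s i lam).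
Proof.
move=> e2 hl az rz; have [M1 h1] := row_bound lam.
have [M2 h2] := row_bound (add_node lam z).
rewrite (@signatureE i lam (M1 + M2)) => [|c]; last by rewrite ltn_addr.
rewrite (@signatureE i _ (M1 + M2)) => [|c]; last by rewrite ltn_addl.
have -> : size (add_node lam z) = size lam.
  by case: z az {rz h2} => [[a b] c] /and3P[/size_add_node].
have flip_cat w1 w2 : flip z (w1 ++ w2) = flip z w1 ++ flip z w2 by apply: map_cat.
have flip0 : flip z [::] = [::] by [].
rewrite (big_morph _ flip_cat flip0); apply: eq_bigr => c _.
rewrite (big_morph _ flip_cat flip0); apply: eq_bigr => a _.
exact: row_sig_add hl _ _.
Qed.

(** The co-good node is the last unmatched one; adding it flips its sign, which by [unmatched_flip]
    shortens the unmatched list by exactly one. *)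
Lemma mp_string i lam : 2 <= e -> is_multipartition (size s) lam ->
  has_string (mp_edge s i) (size (unmatched (signature s i lam))) lam.
Proof.
move=> e2; move En: (size (unmatched _)) => n; elim: n lam En => [//|n IH] lam En hl.
case E: (unmatched _) / lastP En => [//|p z]; rewrite size_rcons => -[pn].
have [az rz] : addable lam z /\ residue_is s i z.
  by apply: (@signature_mem i lam z); apply: unmatched_sub; rewrite E mem_rcons mem_head.
have hm := is_multipartition_add hl az.
exists (add_node lam z).
  split=> //; exists z => //; rewrite /co_good /reduced_signature iter_delete_pairE.
  by rewrite -/(plus_nodes _) -/(unmatched _) E rev_rcons.
apply: IH => //; rewrite (signature_add e2 hl az rz).
by rewrite (unmatched_flip (signature_uniq _ _) E).
Qed.

Lemma sum_residue_is z : 0 < e -> \sum_(i < e) residue_is s i z = 1.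
Proof.
move: z => [[a b] c] e0; set v := (b%:Z - a%:Z + (nth 0%N [seq val t | t <- s] c)%:Z)%R.
have v0 : (0 <= (v %% e)%Z)%R by apply: modz_ge0; lia.
have v1 : ((v %% e)%Z < e%:Z)%R by apply: ltz_pmod; lia.
have ve : (`|(v %% e)%Z| < e)%N by lia.
have E i : residue_is s i (a, b, c) = (i == Ordinal ve).
  rewrite /residue_is -/v (modz_small (m := i%:Z)); last by have := ltn_ord i; lia.
  by rewrite -val_eqE /=; lia.
by rewrite (bigD1 (Ordinal ve)) //= E eqxx big1 // => i /negPf; rewrite E => ->.
Qed.

Lemma count_signature (p : pred bool) i lam M :
  (forall c, size (nth [::] lam c) < M) ->
  count (fun x => p x.2) (signature s i lam) =
    \sum_(c <- iota 0 (size lam)) \sum_(a <- iota 0 M)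
      count (fun x => p x.2) (row_sig i lam c a).
Proof.
move=> hM; rewrite (signatureE i hM).
rewrite (big_morph _ (count_cat _) (erefl : count _ [::] = 0)).
by apply: eq_bigr => c _; rewrite (big_morph _ (count_cat _) (erefl : count _ [::] = 0)).
Qed.

(** Row [a.+1] has an addable node exactly when row [a] has a removable one: both say that row
    [a.+1] is strictly shorter. The addable node of row 0 is left over in each of the [r]
    components. *)
Lemma sum_count_signature r lam : 0 < e -> is_multipartition r lam ->
  \sum_(i < e) count snd (signature s i lam) =
    r + \sum_(i < e) count (fun x => ~~ x.2) (signature s i lam).
Proof.
move=> e0 hl; have [M hM] := row_bound lam.
have {}hM c : size (nth [::] lam c) < M.+1 by rewrite ltnW // ltnS.
pose A c a := addable lam (a, row_len lam c a, c).
pose B c a := removable lam (a, (row_len lam c a).-1, c).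
have hA : \sum_(i < e) count snd (signature s i lam) =
    \sum_(c <- iota 0 (size lam)) \sum_(a <- iota 0 M.+1) A c a.
  under [LHS]eq_bigr => i _ do rewrite (count_signature id i hM).
  rewrite exchange_big /=; apply: eq_bigr => c _.
  rewrite exchange_big /=; apply: eq_bigr => a _.
  under [LHS]eq_bigr => i _ do rewrite count_cat !count_nseq /= mul0n addn0 mul1n -mulnb.
  by rewrite -big_distrr /= sum_residue_is // muln1.
have hB : \sum_(i < e) count (fun x => ~~ x.2) (signature s i lam) =
    \sum_(c <- iota 0 (size lam)) \sum_(a <- iota 0 M.+1) B c a.
  under [LHS]eq_bigr => i _ do rewrite (count_signature negb i hM).
  rewrite exchange_big /=; apply: eq_bigr => c _.
  rewrite exchange_big /=; apply: eq_bigr => a _.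
  under [LHS]eq_bigr => i _ do rewrite count_cat !count_nseq /= mul0n add0n mul1n -mulnb.
  by rewrite -big_distrr /= sum_residue_is // muln1.
have /andP[/eqP <- _] := hl; rewrite hA hB.
have sz : size lam = \sum_(c <- iota 0 (size lam)) 1 by rewrite sum1_size size_iota.
rewrite [X in _ = X + _]sz -big_split /=.
apply: eq_big_seq => c; rewrite mem_iota add0n => /= hc.
rewrite -[0 :: iota 1 M]/(index_iota 0 M.+1) big_nat_recl // big_nat_recr //=.
have -> : A c 0 = true by rewrite /A /addable hc eqxx.
have -> : B c M = false.
  have l0 : row_len lam c M = 0 by rewrite /row_len nth_default // -ltnS.
  by rewrite /B /removable l0 andbF.
rewrite addn0; congr (_ + _); apply: eq_bigr => a _; congr nat_of_bool.
rewrite /A /B /addable /removable hc eqxx /=.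
by apply/idP/andP => [h|[]//]; split=> //; lia.
Qed.

Lemma sum_unmatched_ge r lam : 2 <= e -> is_multipartition r lam ->
  r <= \sum_(i < e) size (unmatched (signature s i lam)).
Proof.
move=> e2 hl; rewrite -(leq_add2r (\sum_(i < e) count (fun x => ~~ x.2) (signature s i lam))).
rewrite -(sum_count_signature (ltnW e2) hl) -big_split /=.
by apply: leq_sum => i _; apply: unmatched_size.
Qed.

(** Edges are undirected in the closure, so what is propagated is an equality of booleans, which is
    symmetric. *)
Lemma Be_vertex_multipartition (v : Be_vertex s) :
  is_multipartition (size s) (sval v).
Proof.
case: v => lam /= h.
have h0 : is_multipartition (size s) (empty_multipartition s).
  by rewrite /is_multipartition size_nseq eqxx; rewrite all_nseq orbT.
have : is_multipartition (size s) (empty_multipartition s) =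
       is_multipartition (size s) lam.
  elim: h => [x y [i [hx hy _]]|//|//|x y z _ -> _ ->] //; by rewrite hx hy.
by rewrite h0 => <-.
Qed.

End Multipartitions.

Lemma has_string_coprod (e : nat) (J : Type) (s : J -> seq 'I_e) i n
    (x : coprod_vertex s) :
  has_string (mp_edge (s (tag x)) i) n (sval (tagged x)) ->
  has_string (@coprod_edge e J s i) n x.
Proof.
elim: n x => //= n IH [j [lam hlam]] /= [mu hmu hn].
have h : clos_refl_sym_trans _ (fun x y => exists i, mp_edge (s j) i x y)
    (empty_multipartition (s j)) mu.
  by apply: rst_trans hlam _; apply: rst_step; exists i.
by exists (Tagged (fun j => Be_vertex (s j)) (exist _ mu h : Be_vertex (s j))) => //; apply: IH.
Qed.

Lemma has_string_iso (I X Y : Type) (edgeX : I -> X -> X -> Prop)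
    (edgeY : I -> Y -> Y -> Prop) (f : X -> Y) i n x :
  crystal_iso edgeX edgeY f ->
  has_string (edgeY i) n (f x) -> has_string (edgeX i) n x.
Proof.
move=> [[g fK gK] fE]; elim: n x => //= n IH x [y xy hy].
by exists (g y); [apply/fE; rewrite gK|apply: IH; rewrite gK].
Qed.

(** * Affine Hecke action from a categorification *)

Section Adjunction.
Variables (k : fieldType) (C : lincat k) (F G : linfunctor C).
Variable adj : adjunction F G.

Definition flat A B (f : mor (F A) B) : mor A (G B) := fmap G f \oc unit_ adj A.
Definition sharp A B (g : mor A (G B)) : mor (F A) B :=
  counit adj B \oc fmap F g.

Lemma flatK A B (f : mor (F A) B) : sharp (flat f) = f.
Proof.
by rewrite /sharp /flat fmap_comp compA -counit_nat -compA triangleF comp_idr.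
Qed.

Lemma sharpK A B (g : mor A (G B)) : flat (sharp g) = g.
Proof.
by rewrite /sharp /flat fmap_comp -compA unit_nat compA triangleG comp_idl.
Qed.

Lemma flat_eq0 A B (f : mor (F A) B) : flat f = 0 -> f = 0.
Proof. by move=> f0; rewrite -(flatK f) f0 /sharp fmap0 compm0. Qed.

Lemma flat_lin A B (a : k) (f g : mor (F A) B) :
  flat (a *: f + g) = a *: flat f + flat g.
Proof. by rewrite /flat fmap_lin comp_linl. Qed.

Lemma flatB A B (a : k) (f g : mor (F A) B) :
  flat (f - a *: g) = flat f - a *: flat g.
Proof. by rewrite -scaleNr addrC flat_lin scaleNr addrC. Qed.

Lemma sharpB A B (a : k) (f g : mor A (G B)) :
  sharp (f - a *: g) = sharp f - a *: sharp g.
Proof. by apply: (can_inj (@flatK A B)); rewrite flatB !sharpK. Qed.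

(** The characteristic property of the mate: adjunction exchanges precomposition with [X] and
    postcomposition with its mate. *)
Lemma flat_mate (X : forall A, mor (F A) (F A)) A B (f : mor (F A) B) :
  natural X -> flat (f \oc X A) = mate adj X B \oc flat f.
Proof.
move=> natX; rewrite -{1}(flatK f); move: (flat f) => g.
by rewrite /sharp -compA natX /flat !fmap_comp -!compA unit_nat.
Qed.

End Adjunction.

Definition precomp (k : fieldType) (C : lincat k) (A S : C) (g : mor A A)
  (f : mor A S) : mor A S := f \oc g.

Fact precomp_is_linear k C A S g : linear (@precomp k C A S g).
Proof. by move=> a f h; rewrite /precomp comp_linl. Qed.

HB.instance Definition _ (k : fieldType) (C : lincat k) (A S : C) (g : mor A A) :=
  GRing.isLinear.Build k (mor A S) (mor A S) *:%R (@precomp k C A S g)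
    (precomp_is_linear g).

(** * The Hecke action on morphisms out of [U^n A] *)

Section HeckePowers.
Variables (k : fieldType) (C : lincat k) (U : linfunctor C) (q a : k).
Variables (X : forall A, mor (U A) (U A)) (T : forall A, mor (U (U A)) (U (U A))).
Hypotheses (X_nat : natural X)
  (T_nat : forall A B (f : mor A B),
    fmap U (fmap U f) \oc T A = T B \oc fmap U (fmap U f))
  (T_quad : forall A, (T A + idm _) \oc (T A - q *: idm _) = 0)
  (TXT : forall A, T A \oc fmap U (X A) \oc T A = q *: X (U A)).

Fixpoint fpow n (A : C) : C := if n is n'.+1 then U (fpow n' A) else A.

(* Positions are counted from the outermost factor of [U^n]. *)
Fixpoint Xpow n A : nat -> mor (fpow n A) (fpow n A) :=
  match n with
  | 0 => fun=> idm A
  | n'.+1 => fun j => if j is j'.+1 then fmap U (Xpow n' A j') else X (fpow n' A)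
  end.

(** [Tpow n A j] acts on positions [j] and [j.+1]; when [j.+1 < n] fails, the value comes from a
    dummy identity. *)
Fixpoint Tpow n A : nat -> mor (fpow n A) (fpow n A) :=
  match n with
  | 0 => fun=> idm A
  | n'.+1 => fun j =>
      if j is j'.+1 then fmap U (Tpow n' A j')
      else if n' is n''.+1 return mor (fpow n'.+1 A) (fpow n'.+1 A)
           then T (fpow n'' A) else idm _
  end.

Lemma Tpow_quad n A j : (j.+1 < n)%N ->
  Tpow n A j \oc Tpow n A j = (q - 1) *: Tpow n A j + q *: idm _.
Proof.
elim: n j => [//|n IH] [|j] /= jn; last by rewrite -fmap_comp IH // fmap_lin fmapZ fmap_id.
case: n IH jn => // n _ _; have := T_quad (fpow n A).
rewrite compDl !compDr !compNr !compZr comp_idl !comp_idr => /eqP.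
rewrite addr_eq0 opprB subr_eq => /eqP ->.
by rewrite scalerBl scale1r addrC addrA addrAC.
Qed.

Lemma Tpow_Xpow n A j : (j.+1 < n)%N ->
  Tpow n A j \oc Xpow n A j.+1 \oc Tpow n A j = q *: Xpow n A j.
Proof.
elim: n j => [//|n IH] [|j] /= jn; last by rewrite -!fmap_comp IH // fmapZ.
by case: n IH jn => // n _ _ /=; rewrite TXT.
Qed.

Lemma Xpow_comm n A i j : (i < n)%N -> (j < n)%N ->
  Xpow n A i \oc Xpow n A j = Xpow n A j \oc Xpow n A i.
Proof.
elim: n i j => [//|n IH] [|i] [|j] //= ii jj.
by rewrite -!fmap_comp IH.
Qed.

Lemma Tpow_Xpow_comm n A i j : (i < n)%N -> (j.+1 < n)%N -> i != j -> i != j.+1 ->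
  Xpow n A i \oc Tpow n A j = Tpow n A j \oc Xpow n A i.
Proof.
elim: n i j => [//|n IH] [|i] [|j] //= ii jj ij ij1.
- case: n IH ii jj => // n IH ii jj; case: i ii ij ij1 => // i ii _ _.
  by rewrite /= T_nat.
- by rewrite -!fmap_comp IH.
Qed.

(** Precomposition reverses products, but the relations of [hecke_action] read the same in both
    directions. *)
Lemma precomp_hecke_action n A S :
  hecke_action q n (fun j => @precomp k C _ S (Xpow n A j))
    (fun j => @precomp k C _ S (Tpow n A j)).
Proof.
split=> [j f|j f|i j f|i j f] *; rewrite /= /precomp.
- by rewrite -compA Tpow_quad // compDr !compZr comp_idr.
- by rewrite -!compA (compA (Tpow _ _ _)) Tpow_Xpow // compZr.
- by rewrite -!compA Xpow_comm.
- by rewrite -!compA Tpow_Xpow_comm.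
Qed.

Variables (V : linfunctor C) (adj : adjunction U V).
Let y S := mate adj X S - a *: idm (V S).
Let x n A S j : mor (fpow n A) S -> mor (fpow n A) S :=
  shift_by a (@precomp k C _ S (Xpow n A j)).

(** Position 0 is the outermost [U], the one that adjunction moves to [V] on the target. *)
Lemma flat_shift n A S N (f : mor (fpow n.+1 A) S) :
  flat adj (iter N (@x n.+1 A S 0%N) f) = endo_pow (y S) N \oc flat adj f.
Proof.
elim: N => [|N IH]; first by rewrite comp_idl.
rewrite iterS endo_powS -compA -IH; move: (iter _ _ _) => g.
rewrite /x /shift_by flatB /= /precomp flat_mate //.
by rewrite /y compDl compNl compZl comp_idl.
Qed.

(** Positions beyond 0 come from the inner [U^n], so they pass through the adjunction with their
    index lowered by one. *)
Lemma sharp_shift n A S M N j (f : mor (fpow n A) M) (i : mor M (V S)) :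
  iter N (@x n.+1 A S j.+1) (sharp adj (i \oc f)) =
  sharp adj (i \oc iter N (@x n A M j) f).
Proof.
elim: N => //= N ->; rewrite /x /shift_by /= /precomp.
rewrite compDr compNr compZr sharpB; congr (_ - _).
by rewrite /sharp -!compA -fmap_comp -!compA.
Qed.

End HeckePowers.

Section RootOfUnity.
Variables (R : realType) (e : nat).

Lemma qroot_neq0 : qroot R e != 0.
Proof.
apply/eqP => -[c0 s0]; have := cos2Dsin2 (2 * pi / e%:R : R).
by rewrite c0 s0 expr0n addr0 => /eqP; rewrite eq_sym oner_eq0.
Qed.

(** The angle lies in []0, pi]] and the cosine is injective on [[0, pi]], so already the real part
    differs from 1. *)
Lemma qroot_neq1 : (2 <= e)%N -> qroot R e != 1.
Proof.
move=> e2; apply/eqP => -[c1 _].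
have pi0 := pi_gt0 R; have e0 : 0 < e%:R :> R by rewrite ltr0n; lia.
have x0 : 0 < 2 * pi / e%:R :> R by rewrite divr_gt0 ?mulr_gt0.
have xpi : 2 * pi / e%:R <= pi :> R.
  by rewrite ler_pdivrMr // mulrC ler_pM2l // ler_nat.
have : 2 * pi / e%:R = 0 :> R.
  apply: cos_inj; rewrite ?cos0 // in_itv /= ?lexx ?(ltW x0) ?(ltW pi0) //.
by move=> h; rewrite h ltxx in x0.
Qed.

End RootOfUnity.

(** * String lengths bound the length of [V_i(S)] *)

Section Categorification.
Variables (R : realType) (e : nat) (C : lincat R[i]).
Variable cat : slhat_categorification e C.
Hypotheses (abC : abelian C) (artC : artinian C) (e2 : (2 <= e)%N).
Hypothesis hV : forall A : C, is_sum_via (fun i : 'I_e => cVi_incl cat i A).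

Let q := qroot R e.

(** [V_i] is a direct summand of the exact functor [V]; naturality of the projections follows from
    that of the inclusions. *)
Lemma cVi_epi i A B (f : mor A B) : is_epi f -> is_epi (fmap (cVi cat i) f).
Proof.
move=> ef; have [pA [pA1 pA0 pAs]] := hV A; have [pB [pB1 pB0 pBs]] := hV B.
have prj_nat : pB i \oc fmap (cV cat) f = fmap (cVi cat i) f \oc pA i.
  rewrite -[LHS]comp_idr -pAs comp_sumr (bigD1 i) //= big1 ?addr0 => [|j ji].
    rewrite compA -(compA (pB i)) (cVi_nat cat) compA pB1.
    by rewrite comp_idl.
  rewrite compA -(compA (pB i)) (cVi_nat cat) compA pB0 //.
  by rewrite !comp0m.
have eV : is_epi (fmap (cV cat) f) := exact_functor_epi abC (cV_exact cat) ef.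
have epB : is_epi (pB i) := split_epi (pB1 i).
have h : is_epi (fmap (cVi cat i) f \oc pA i).
  by rewrite -prj_nat; apply: epi_comp.
apply: epi_of_coker0 => D g g0; apply: (epi_eq0 h).
by rewrite compA g0 comp0m.
Qed.

Fixpoint cVi_pow i n (S : C) : C :=
  if n is n'.+1 then cVi_pow i n' (cVi cat i S) else S.

Lemma cVi_pow_epi i n A B (f : mor A B) : is_epi f ->
  exists g : mor (cVi_pow i n A) (cVi_pow i n B), is_epi g.
Proof.
elim: n A B f => [|n IH] A B f ef; first by exists f.
by apply: (IH _ _ (fmap (cVi cat i) f)); apply: cVi_epi.
Qed.

(** An edge yields an epimorphism from [V_i(S)] onto the next simple object, since a head is a
    quotient. As [V_i] preserves epimorphisms, [V_i^n(S)] maps onto the simple object ending the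
    string. *)
Lemma cVi_pow_string i n (x : cat_vertex C) (S : C) : sval x S ->
  has_string (cat_edge cat i) n x -> ~ is_zero (cVi_pow i n S).
Proof.
have vertexE (v : cat_vertex C) A B : sval v A -> sval v B -> isoc A B.
  case: v => P /= [S0 _ ->] /isoc_sym h1 h2; exact: isoc_trans h1 h2.
elim: n x S => [|n IH] x S.
  case: x => P /= [S0 [nz _] ->] [u iu] _ zS; apply: nz.
  exact: mono_is_zero (iso_mono iu) zS.
move=> xS [z [S1 [S' [H [xS1 zS' [p [ep _ _]] [u iu]]]]] hn] /= zero.
have [w iw] := vertexE _ _ _ xS xS1.
have ef := epi_comp (epi_comp (iso_epi iu) ep) (@cVi_epi i _ _ _ (iso_epi iw)).
have [g eg] := @cVi_pow_epi i n _ _ _ ef.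
by apply: (IH z S' zS' hn); apply: epi_is_zero eg zero.
Qed.

Let Upow := fpow (cU cat).
Let a (i : 'I_e) := q ^+ i.
Let X n A S j : {linear mor (Upow n A) S -> mor (Upow n A) S} :=
  @precomp _ C _ S (Xpow (cX cat) n A j).
Let y i S := mate (cadj cat) (cX cat) S - a i *: idm (cV cat S).

(* The adjunctions turn the inclusion of [V_i^n S] in [V^n S] into [f]. *)
Lemma cVi_pow_gen_eigen i n (S : C) : ~ is_zero (cVi_pow i n S) ->
  exists f : mor (Upow n (cVi_pow i n S)) S,
    f <> 0 /\ gen_eigen (a i) n (X n (cVi_pow i n S) S) f.
Proof.
elim: n S => [|n IH] S nz.
  by exists (idm S); split=> // S0; apply: nz; apply/is_zero_idm.
have [f [f0 hf]] := IH _ nz; have [N /(_ N (leqnn N)) ker] := cVi_eigen cat i S.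
exists (sharp (cadj cat) (cVi_incl cat i S \oc f)); split=> [h|j jn].
  apply: f0; apply: (mono_eq0 (kernel_mono ker)).
  by rewrite -(sharpK (cadj cat) (_ \oc f)) h /flat fmap0 comp0m.
case: j jn => [|j] jn.
  exists N; apply: (flat_eq0 (adj := cadj cat)).
  rewrite (flat_shift (a i) (@cX_nat _ _ _ cat)) sharpK compA (proj1 ker).
  by rewrite comp0m.
have [M hM] := hf j jn; exists M.
rewrite (sharp_shift (a i) (cX cat)) [X in _ \oc X]hM compm0.
by rewrite /sharp fmap0 compm0.
Qed.

Lemma at_least_string i n (S : C) : ~ is_zero (cVi_pow i n S) ->
  at_least_constituents n (cVi cat i S).
Proof.
case: n => [|n] nz; first exact: at_least0.
have [N ker] := cVi_eigen cat i S; set j := cVi_incl cat i S in ker.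
have mj : is_mono j := kernel_mono (ker N (leqnn N)).
(* [z] is the restriction of [y i S] to its generalized kernel [V_i(S)], which it preserves because
   it commutes with its own powers. *)
have [|z zE] := @kernel_lift _ _ _ _ _ _ _ _ (y i S \oc j) (ker N (leqnn N)).
  rewrite compA -endo_powSr endo_powS -compA (proj1 (ker N (leqnn N))).
  by rewrite compm0.
have zpow m : j \oc endo_pow z m = endo_pow (y i S) m \oc j.
  elim: m => [|m IH]; first by rewrite comp_idl comp_idr.
  by rewrite !endo_powS compA zE -compA IH compA.
apply: (@at_least_nilpotent _ _ abC artC _ z N n).
  by apply: (mono_eq0 mj); rewrite zpow; case: (ker N (leqnn N)).
move=> zn0; have [f [f0 hf]] := cVi_pow_gen_eigen nz; apply: f0.
have q0 : q != 0 := qroot_neq0 R e; have q1 : q != 1 := qroot_neq1 R e2.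
have a0 : a i != 0 by rewrite expf_neq0.
have hact := precomp_hecke_action (@cX_nat _ _ _ cat) (@cT_nat _ _ _ cat)
  (@cT_quad _ _ _ cat) (@cTX _ _ _ cat) n.+1 (cVi_pow i n.+1 S) S.
(* The subspace is the whole joint generalized eigenspace, which is stable under the action and
   contains [f]; the exponent is [n], for [n.+1] positions. *)
apply: (@hecke_module_eq0 _ q (a i) _ q0 q1 a0 n n.+1 _ _ _ (ltnSn n) hact
  (gen_eigen_subspace _ _ _)) hf => //.
- by move=> l g ln hg; apply: gen_eigen_X hact _ hg.
- by move=> l g ln hg; apply: gen_eigen_T hact _ hg.
(* A priori the exponent [M] depends on [g]. But the kernel of [y^(N + M)] is still [V_i(S)], so
   [flat g] factors through it, and [z^n = 0] gives the uniform exponent [n]. *)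
move=> g hg; have [M hM] := hg 0%N erefl.
apply: (flat_eq0 (adj := cadj cat)).
rewrite (flat_shift (a i) (@cX_nat _ _ _ cat)).
have [|h hE] := @kernel_lift _ _ _ _ _ _ _ _ (flat (cadj cat) g) (ker (N + M)%N (leq_addr _ _)).
  rewrite endo_powD -compA -(flat_shift (a i) (@cX_nat _ _ _ cat)) [X in flat _ X]hM.
  by rewrite /flat fmap0 comp0m compm0.
by rewrite -hE compA -zpow zn0 compm0 comp0m.
Qed.

End Categorification.

Theorem theorem1p18 (R : realType) (e : nat) (he : (2 <= e)%N)
  (C : lincat R[i]) (abC : abelian C) (artC : artinian C)
  (cat : slhat_categorification e C)
  (hV : forall A : C, is_sum_via (fun i : 'I_e => cVi_incl cat i A))
  (hO : in_Oint (crep cat))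
  (J : Type) (lam : J -> wtlattice e) (hlam : forall j, dominant (lam j))
  (hdec : decomposes_as (crep cat) lam)
  (s : J -> seq 'I_e) (hs : forall j, charge_of (lam j) (s j))
  (Psi : cat_vertex C -> coprod_vertex s)
  (hPsi : crystal_iso (cat_edge cat) (@coprod_edge e J s) Psi)
  (S : C) (hS : is_simple S)
  (r : nat) (t : r.-tuple 'I_e) (ht : is_charge t)
  (hr : s (tag (Psi (simple_class hS))) = t) :
  at_least_constituents r (cV cat S).
Proof.
set v := Psi _ in hr.
have hmu := Be_vertex_multipartition (tagged v).
(* The number of co-normal [i]-nodes of the multipartition attached to [S]. *)
pose n i := size (unmatched (signature (s (tag v)) i (sval (tagged v)))).
have hn i : at_least_constituents (n i) (cVi cat i S).
  apply: (at_least_string abC artC he); apply: (@cVi_pow_string _ _ _ cat abC hV i _ (simple_class hS)).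
    by exists (idm S), (idm S); rewrite comp_idl.
  by apply: (has_string_iso hPsi); apply: has_string_coprod; apply: mp_string.
have [prj [prj1 prj0 _]] := hV S.
have [l [hl nl]] := at_least_summands abC artC (index_enum_uniq 'I_e)
  (fun i _ => prj1 i) (fun i j _ _ => prj0 i j) hn.
exists l; split=> //; apply: leq_trans nl.
have <- : size (s (tag v)) = r by rewrite hr size_tuple.
exact: sum_unmatched_ge he hmu.
Qed.
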